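(* Let $X$ be a Banach space, $f:X\to\mathbb{R}\cup\{+\infty\}$ lower semicontinuous and $\bar x\in[f\le0]$. Let $\tau>0$ and $\delta\in(0,\infty]$. Suppose that either $X$ is Asplund or $f$ is convex, and $$d(0,\partial f(x))\ge\tau\quad\text{for all } x\in B_\delta(\bar x)\cap[f>0]\text{ with } f(x)<\tau\, d(x,[f\le0]).$$ Then $\alpha\tau\, d(x,[f\le0])\le f_+(x)$ for all $\alpha\in(0,1]$ and all $x\in B_{\delta/(1+\alpha)}(\bar x)$.
   Context: $[f\le0]=\{x: f(x)\le0\}$, $[f>0]=\{x:f(x)>0\}$, $f_+(x)=\max\{f(x),0\}$. $B_\delta(x)$ is the open ball of radius $\delta$ centered at $x$ ($B_\infty(x)=X$). $d(x,A)=\inf_{a\in A}\|x-a\|$ with $d(x,\emptyset)=+\infty$. $\partial f(x)$ is the Fréchet subdifferential: $\{x^*\in X^*:\liminf_{y\to x}\frac{f(y)-f(x)-\langle x^*,y-x\rangle}{\|y-x\|}\ge0\}$ if $f(x)<+\infty$, and $\emptyset$ otherwise (it coincides with the convex subdifferential for convex $f$); $d(0,\partial f(x))=\inf\{\|x^*\|: x^*\in\partial f(x)\}$ ($=+\infty$ if empty). A Banach space is Asplund if every continuous convex function on an open convex subset is Fréchet differentiable on a dense subset. *)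

(* Defs.v *)
From HB Require Import structures.
From mathcomp Require Import all_boot all_order all_algebra.
From mathcomp Require Import all_classical all_reals all_analysis.
Set Implicit Arguments. Unset Strict Implicit. Unset Printing Implicit Defensive.
Import Order.TTheory GRing.Theory Num.Theory.
Import numFieldNormedType.Exports.
Local Open Scope classical_set_scope.
Local Open Scope ring_scope.

Section Defs.
Context {R : realType} {X : normedModType R}.

Definition is_dual (xs : X -> R) : Prop :=
  (forall (a : R) (x y : X), xs (a *: x + y) = a * xs x + xs y) /\ continuous xs.

Definition dual_norm (xs : X -> R) : \bar R :=
  ereal_sup [set (`|xs x|)%:E | x in [set x : X | `|x| <= 1]].

Definition frechet_subdiff (f : X -> \bar R) (x : X) : set (X -> R) :=
  [set xs | is_dual xs /\ (f x < +oo)%E /\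
    (0 <= limf_einf
            (fun y => (f y - f x - (xs (y - x))%:E) * ((`|y - x|)^-1)%:E)
            x^')%E].

(* d(0, ∂f(x)) = inf { ||x^*|| : x^* ∈ ∂f(x) }, +oo if empty *)
Definition dist0_subdiff (f : X -> \bar R) (x : X) : \bar R :=
  ereal_inf [set dual_norm xs | xs in frechet_subdiff f x].

(* d(x, A) = inf_{a in A} ||x - a||, with d(x, emptyset) = +oo *)
Definition dist (x : X) (A : set X) : \bar R :=
  ereal_inf [set (`|x - a|)%:E | a in A].

Definition sublevel0 (f : X -> \bar R) : set X := [set x | (f x <= 0)%E].
Definition pos_part (f : X -> \bar R) (x : X) : \bar R := Order.max (f x) 0%E.

(* open ball B_delta(x) with delta in (0, +oo]; B_{+oo}(x) = X *)
Definition eball (x : X) (delta : \bar R) : set X :=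
  [set y | ((`|y - x|)%:E < delta)%E].

Definition convex_efun (f : X -> \bar R) : Prop :=
  forall (x y : X) (t : R), 0 < t < 1 ->
    (f (t *: x + (1 - t) *: y)%R <= t%:E * f x + (1 - t)%R%:E * f y)%E.

Definition convex_subset (U : set X) : Prop :=
  forall (x y : X) (t : R), U x -> U y -> 0 <= t <= 1 -> U (t *: x + (1 - t) *: y).

Definition convex_on (U : set X) (g : X -> R) : Prop :=
  forall (x y : X) (t : R), U x -> U y -> 0 <= t <= 1 ->
    g (t *: x + (1 - t) *: y) <= t * g x + (1 - t) * g y.

End Defs.

Definition asplund {R : realType} (X : normedModType R) : Prop :=
  forall (U : set X) (g : X -> R),
    open U -> convex_subset U -> {within U, continuous g} -> convex_on U g ->
    exists D : set X, D `<=` U /\ U `<=` closure D /\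
      (forall x, D x -> differentiable g x).

(* Main.v *)
Require Import Defs.
From mathcomp Require Import all_boot all_order all_algebra.
From mathcomp Require Import all_classical all_reals all_analysis.
From mathcomp Require Import ring lra.
Import Order.TTheory GRing.Theory Num.Theory.
Import numFieldNormedType.Exports.
Local Open Scope classical_set_scope.
Local Open Scope ring_scope.

(* Suppose the estimate fails at [x], put [F = f_+] and choose [c < tau]
   accordingly.  A smooth variational principle started at [x] yields [y] and a
   convex Lipschitz [h], of constant at most [c + mu] < [tau], such that [y]
   minimizes [F + h] and [F y + c |y - x|] is at most slightly above [F x]; hence
   [y] lies in the ball, [0 < f y < tau * d(y, S)] for the sublevel set [S], and it
   remains to find a subgradient of [F] at [y] of norm at most [c + mu].
   If [f] is convex, separate [F] from the cone [- (c + mu) |. - y|].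
   If [X] is Asplund, work in a separable closed subspace [Y] that reflects the
   failure of Frechet subdifferentiability of [F] by its finite families of
   points.  Then the dual ball is separable on [Y], and an infimal convolution
   built on functionals [c n] dense in it makes [h] Frechet smooth along [Y], so
   that the opposite of a subgradient of [h] at [y] is a Frechet subgradient of
   [F] along [Y], and the reflection provides one on the whole of [X]. *)

(** A subgradient along [Y] cannot be lifted by a plain Hahn-Banach extension, since outside [Y] it
    has to respect the values of [F]. What can be lifted is solvability. Once a radius is fixed for
    every tolerance, having a Fréchet subgradient of norm at most [c] at [y] means solving a system
    of inequalities [a u <= F (y + u) - F y + slack] under [|a| <= c], and by Hahn-Banach such a
    system is solvable as soon as no finite nonnegative combination of its members is contradictory.
    A contradiction thus involves finitely many points and has a numerical margin, which survives
    small changes of [y] and [F y]; this is why countably many families of points can serve all [y]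
    of the closed subspace at once. On the side of smoothness no equivalent smooth norm is built: a
    convex 1-Lipschitz gauge that vanishes at 0 and is at least the norm minus [rho] is enough for
    the variational principle. *)

(** * Sublinear functions and Hahn-Banach theorems *)

Section Sublinear.
Context {R : realType} {X : lmodType R}.
Implicit Types (p q : X -> R) (K : X -> R -> Prop).

Definition sublinear p :=
  (forall x y, p (x + y) <= p x + p y) /\
  (forall (t : R) x, 0 <= t -> p (t *: x) <= t * p x).

Definition linear_fun (a : X -> R) :=
  forall (s : R) x y, a (s *: x + y) = s * a x + a y.

Lemma linear_fun0 {a} : linear_fun a -> a 0 = 0.
Proof. by move=> la; have := la 1 0 0; rewrite scaler0 addr0; lra. Qed.

Lemma linear_funZ {a} (la : linear_fun a) s x : a (s *: x) = s * a x.
Proof. by have := la s x 0; rewrite addr0 linear_fun0 // addr0. Qed.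

Lemma linear_funD {a} (la : linear_fun a) x y : a (x + y) = a x + a y.
Proof. by have := la 1 x y; rewrite scale1r mul1r. Qed.

Lemma linear_funN {a} (la : linear_fun a) x : a (- x) = - a x.
Proof. by rewrite -scaleN1r linear_funZ // mulN1r. Qed.

Lemma linear_funB {a} (la : linear_fun a) x y : a (x - y) = a x - a y.
Proof. by rewrite linear_funD // linear_funN. Qed.

Lemma sublinear0 {p} : sublinear p -> p 0 = 0.
Proof.
move=> [pD pZ]; have := pD 0 0; have := pZ 0 0 (lexx _).
by rewrite scale0r addr0; lra.
Qed.

Lemma sublinearZ {p} (sp : sublinear p) (t : R) x : 0 <= t -> p (t *: x) = t * p x.
Proof.
move=> t0; apply/eqP; rewrite eq_le sp.2 //=.
have [->|t_neq0] := eqVneq t 0; first by rewrite scale0r mul0r sublinear0.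
have tgt0 : 0 < t by rewrite lt_def t_neq0.
have := sp.2 t^-1 (t *: x); rewrite invr_ge0 scalerA mulVf // scale1r => /(_ t0).
by rewrite mulrC ler_pdivlMr // mulrC.
Qed.

Lemma sublinearN {p} : sublinear p -> forall x, - p (- x) <= p x.
Proof. by move=> sp x; have := sp.1 x (- x); rewrite subrr sublinear0 //; lra. Qed.

Lemma le_inf_add (A B : set R) y : A !=set0 -> B !=set0 ->
  (forall a b, A a -> B b -> y <= a + b) -> y <= inf A + inf B.
Proof.
move=> A0 B0 yAB; rewrite -lerBlDl; apply: lb_le_inf => // b Bb.
rewrite lerBlDl -lerBlDr; apply: lb_le_inf => // a Aa.
by rewrite lerBlDr; exact: yAB.
Qed.

(** [K w r] is read as the constraint [a w <= r] on a linear functional [a] that is sought;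
    constraints of this kind add up and scale. *)
Definition is_cone K :=
  [/\ K 0 0, forall v w r s, K v r -> K w s -> K (v + w) (r + s)
    & forall (t : R) v r, 0 < t -> K v r -> K (t *: v) (t * r)].

(** The infimal convolution of [p] with the constraints: the greatest sublinear function below [p]
    that obeys all of them, provided they are compatible with [p]. *)
Definition cone_inf p K (v : X) : R :=
  inf [set z | exists w r, K w r /\ z = r + p (v - w)].

Lemma cone_inf_le {p K} : sublinear p ->
  (forall w r, K w r -> 0 <= r + p (- w)) ->
  forall v w r, K w r -> cone_inf p K v <= r + p (v - w).
Proof.
move=> sp Kp v w r Kwr; apply: ge_inf; last by exists w, r.
exists (- p (- v)) => _ [w' [r' [Kw'r' ->]]].
have := Kp _ _ Kw'r'; have := sp.1 (v - w') (- v).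
by rewrite addrAC subrr sub0r; lra.
Qed.

Lemma cone_inf_ge {p K} v y : K 0 0 ->
  (forall w r, K w r -> y <= r + p (v - w)) -> y <= cone_inf p K v.
Proof.
move=> K00 H; apply: lb_le_inf; first by exists (0 + p (v - 0)); exists 0, 0.
by move=> _ [w [r [Kwr ->]]]; exact: H.
Qed.

Lemma cone_inf_sublinear {p K} : sublinear p -> is_cone K ->
  (forall w r, K w r -> 0 <= r + p (- w)) -> sublinear (cone_inf p K).
Proof.
move=> sp [K00 KD KZ] Kp; split=> [x y|t x].
  apply: le_inf_add; first by exists (0 + p (x - 0)); exists 0, 0.
    by exists (0 + p (y - 0)); exists 0, 0.
  move=> _ _ [v [r [Kv ->]]] [w [s [Kw ->]]].
  apply: le_trans (cone_inf_le sp Kp _ _ _ (KD _ _ _ _ Kv Kw)) _.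
  have := sp.1 (x - v) (y - w); rewrite opprD addrACA; lra.
rewrite le_eqVlt => /predU1P[<-|t0].
  rewrite mul0r scale0r.
  by have := cone_inf_le sp Kp 0 _ _ K00; rewrite subr0 (sublinear0 sp) addr0.
rewrite mulrC -ler_pdivrMr // mulrC; apply: cone_inf_ge => // w r Kwr.
rewrite mulrC ler_pdivrMr // mulrDl [r * t]mulrC [p _ * t]mulrC.
rewrite -(sublinearZ sp _ _ (ltW t0)) scalerBr.
exact: (cone_inf_le sp Kp _ _ _ (KZ _ _ _ t0 Kwr)).
Qed.

(** Zorn's lemma. The infimum of a chain is finite because [- p0 (- x)] bounds it below, and
    subadditive because the smaller of two members serves both arguments. The lower bound [q] on [Y]
    is void for Hahn-Banach and is a support function in [dual_ball_covered]. *)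
Lemma minimal_sublinear {p0} (Y : set X) (q : X -> R) : sublinear p0 ->
  (forall y, Y y -> q y <= p0 y) ->
  exists p, [/\ sublinear p, forall x, p x <= p0 x, forall y, Y y -> q y <= p y
    & forall p', sublinear p' -> (forall x, p' x <= p x) ->
      (forall y, Y y -> q y <= p' y) -> forall x, p x <= p' x].
Proof.
move=> sp0 qp0.
pose P p := [/\ sublinear p, forall x, p x <= p0 x & forall y, Y y -> q y <= p y].
have Pp0 : P p0 by split.
pose T := {p | P p}.
pose Rel (s t : T) := `[< forall x, sval t x <= sval s x >].
have [||A totA|[p [sp pp0 qp]] pmin] := @ZL_preorder T (exist _ p0 Pp0) Rel.
- by move=> t; exact/asboolP.
- move=> r s t /asboolP rs /asboolP st; apply/asboolP => x.
  exact: le_trans (st x) (rs x).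
- have [[s0 As0]|A0] := pselect (A !=set0); last first.
    by exists (exist _ p0 Pp0) => s As; case: A0; exists s.
  pose V x := [set sval s x | s in A].
  have VN x : V x !=set0 by exists (sval s0 x); exists s0.
  have Vle s x : A s -> inf (V x) <= sval s x.
    move=> As; apply: ge_inf; last by exists s.
    exists (- p0 (- x)) => _ [[p [sp pp0 ?]] _ <-] /=.
    by apply: le_trans (sublinearN sp x); rewrite lerN2.
  have Pm : P (fun x => inf (V x)).
    split=> [|x|y Yy].
    + split=> [x y|t x t0].
        apply: le_inf_add => // _ _ [s As <-] [t At <-].
        have [/asboolP st|/asboolP st] := totA _ _ As At.
          apply: le_trans (Vle _ _ At) _; case: t st {At} => /= t [st' _ _] st.
          apply: le_trans (st'.1 x y) _; exact: lerD.
        apply: le_trans (Vle _ _ As) _; case: s st {As} => /= s [st' _ _] st.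
        apply: le_trans (st'.1 x y) _; exact: lerD.
      have [->|tn0] := eqVneq t 0.
        rewrite mul0r scale0r; apply: le_trans (Vle s0 _ As0) _.
        by case: s0 As0 => s [ss _ _] _ /=; rewrite sublinear0.
      have tgt0 : 0 < t by rewrite lt_def tn0.
      rewrite mulrC -ler_pdivrMr //; apply: lb_le_inf => // _ [s As <-].
      rewrite ler_pdivrMr //; apply: le_trans (Vle _ _ As) _.
      by case: s As => s [ss _ _] _ /=; rewrite mulrC; exact: ss.2.
    + by apply: le_trans (Vle _ _ As0) _; case: s0 {As0} => s [].
    + apply: lb_le_inf => //.
      by move=> _ [[s [? ? sq]] _ <-] /=; exact: sq.
  exists (exist _ _ Pm) => s As; apply/asboolP => x /=; exact: Vle.
exists p; split=> // p' sp' p'p qp' x.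
have Pp' : P p' by split=> // z; exact: le_trans (p'p z) (pp0 z).
have /asboolP := pmin (exist _ p' Pp') (asboolT p'p).
exact.
Qed.

(** Imposing [a (- x) <= - p x] is compatible with [p], so by minimality it does not lower [p]; at
    [y] this reads [p y <= p (x + y) - p x], the missing half of additivity. *)
Lemma minimal_sublinear_linear p : sublinear p ->
  (forall p', sublinear p' -> (forall x, p' x <= p x) -> forall x, p x <= p' x) ->
  linear_fun p.
Proof.
move=> sp pmin.
have pD x y : p (x + y) = p x + p y.
  apply/eqP; rewrite eq_le sp.1 /=.
  pose K v r := exists t : R, [/\ 0 <= t, v = - (t *: x) & r = - (t * p x)].
  have cK : is_cone K.
    split=> [|v w r s [t [t0 -> ->]] [u [u0 -> ->]]|t v r t0 [u [u0 -> ->]]].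
    - by exists 0; split; rewrite ?scale0r ?mul0r ?oppr0.
    - by exists (t + u); split; rewrite ?addr_ge0 // ?scalerDl ?mulrDl opprD.
    - exists (t * u); split; first by rewrite mulr_ge0 // ltW.
        by rewrite scalerN scalerA.
      by rewrite mulrN mulrA.
  have Kp w r : K w r -> 0 <= r + p (- w).
    by move=> [t [t0 -> ->]]; rewrite opprK sublinearZ // addNr.
  have K1 : K (- x) (- p x) by exists 1; split; rewrite ?scale1r ?mul1r.
  have [K00 _ _] := cK.
  have cle z : cone_inf p K z <= p z.
    by have := cone_inf_le sp Kp z _ _ K00; rewrite add0r subr0.
  have := pmin _ (cone_inf_sublinear sp cK Kp) cle y.
  have := cone_inf_le sp Kp y _ _ K1; rewrite opprK addrC [y + x]addrC; lra.
have p0 := sublinear0 sp.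
have pN x : p (- x) = - p x by have := pD x (- x); rewrite subrr p0; lra.
move=> s x y; rewrite pD; congr (_ + _).
have [s0|s0] := leP 0 s; first exact: sublinearZ.
have Ns0 : 0 <= - s by rewrite oppr_ge0 ltW.
by rewrite -[s]opprK scaleNr pN (sublinearZ sp _ _ Ns0) !mulNr.
Qed.

Lemma hahn_banach {p} : sublinear p ->
  exists a, linear_fun a /\ forall x, a x <= p x.
Proof.
move=> sp.
have [//|a [sa ap _ amin]] := minimal_sublinear set0 (fun=> 0) sp.
by exists a; split=> //; apply: minimal_sublinear_linear => // p' ? ?; exact: amin.
Qed.

(** Each constraint only has to be compatible with [p] by itself, because [K] already contains the
    combinations of its members. *)
Lemma hahn_banach_cone {p} K : sublinear p -> is_cone K ->
  (forall w r, K w r -> 0 <= r + p (- w)) ->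
  exists a, [/\ linear_fun a, forall x, a x <= p x & forall w r, K w r -> a w <= r].
Proof.
move=> sp cK Kp; have [K00 _ _] := cK.
have [a [la ap]] := hahn_banach (cone_inf_sublinear sp cK Kp).
exists a; split=> // [x|w r Kwr]; apply: le_trans (ap _) _.
  by have := cone_inf_le sp Kp x _ _ K00; rewrite add0r subr0.
by have := cone_inf_le sp Kp w _ _ Kwr; rewrite subrr (sublinear0 sp) addr0.
Qed.

End Sublinear.

(** * Separation by functionals of bounded norm *)

Section BoundedFunctionals.
Context {R : realType} {X : normedModType R}.
Implicit Types (a : X -> R) (C K : X -> R -> Prop).

Definition dual_ball (c : R) a := linear_fun a /\ forall x, `|a x| <= c * `|x|.

Definition lipschitz_const (L : R) (g : X -> R) :=
  forall x y, g x <= g y + L * `|x - y|.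

Lemma norm_sublinear {c : R} : 0 <= c -> sublinear (fun x : X => c * `|x|).
Proof.
move=> c0; split=> [x y|t x t0]; first by rewrite -mulrDr ler_wpM2l // ler_normD.
by rewrite normrZ ger0_norm // mulrCA.
Qed.

Lemma dual_ballP {c : R} {a} : linear_fun a -> (forall x, a x <= c * `|x|) ->
  dual_ball c a.
Proof.
move=> la ac; split=> // x; rewrite ler_norml ac andbT.
by have := ac (- x); rewrite linear_funN // normrN; lra.
Qed.

Lemma dual_ball_le {c a x} : dual_ball c a -> a x <= c * `|x|.
Proof. by move=> [_ /(_ x)]; apply: le_trans; exact: ler_norm. Qed.

Lemma dual_ball_cone {c : R} K : 0 <= c -> is_cone K ->
  (forall w r, K w r -> 0 <= r + c * `|w|) ->
  exists a, dual_ball c a /\ forall w r, K w r -> a w <= r.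
Proof.
move=> c0 cK Kc.
have [w r /Kc|a [la ac aK]] := hahn_banach_cone K (norm_sublinear c0) cK.
  by rewrite normrN.
by exists a; split=> //; exact: dual_ballP.
Qed.

(** A convex set of constraints generates a cone by positive scaling, and the compatibility
    condition is homogeneous. *)
Lemma dual_ball_convex {c : R} C : 0 <= c -> C 0 0 ->
  (forall v w r s (t : R), 0 < t < 1 -> C v r -> C w s ->
    C (t *: v + (1 - t) *: w) (t * r + (1 - t) * s)) ->
  (forall w r, C w r -> 0 <= r + c * `|w|) ->
  exists a, dual_ball c a /\ forall w r, C w r -> a w <= r.
Proof.
move=> c0 C00 cC Cc.
pose K v r := exists (t : R) h b, [/\ 0 < t, C h b, v = t *: h & r = t * b].
have [|w r [t [h [b [t0 Chb -> ->]]]]|a [ac aK]] := @dual_ball_cone c K c0.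
- split=> [|v w r s [t [h [b [t0 Chb -> ->]]]] [u [k [d [u0 Ckd -> ->]]]]|].
  + by exists 1, 0, 0; rewrite scaler0 mulr0.
  + have tu0 : 0 < t + u by exact: addr_gt0.
    have tuN : t + u != 0 by rewrite gt_eqF.
    have E : 1 - t / (t + u) = u / (t + u) by field.
    exists (t + u), (t / (t + u) *: h + u / (t + u) *: k),
      (t / (t + u) * b + u / (t + u) * d); split=> //.
    * rewrite -E; apply: cC => //; rewrite divr_gt0 //=.
      by rewrite ltr_pdivrMr // mul1r ltrDl.
    * by rewrite scalerDr !scalerA ![(t + u) * _]mulrC !divfK.
    * by field.
  + move=> t v r t0 [u [h [b [u0 Chb -> ->]]]].
    by exists (t * u), h, b; rewrite mulr_gt0 // scalerA mulrA.
- have := Cc _ _ Chb; rewrite normrZ gtr0_norm // mulrCA -mulrDr => ?.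
  by rewrite mulr_ge0 // ltW.
exists a; split=> // w r Cwr; apply: aK.
by exists 1, w, r; rewrite scale1r mul1r.
Qed.

Lemma convex_on_subgradient {L : R} {g : X -> R} x : 0 <= L ->
  convex_on setT g -> lipschitz_const L g ->
  exists a, dual_ball L a /\ forall u, g x + a u <= g (x + u).
Proof.
move=> L0 cg Lg.
have [|v w r s t t01 Cv Cw|w r|a [aL aC]] :=
  @dual_ball_convex L (fun h r => g (x + h) - g x <= r) L0.
- by rewrite addr0 subrr.
- have /andP[t0 t1] := t01.
  have := cg (x + v) (x + w) t I I; rewrite (ltW t0) (ltW t1) => /(_ isT).
  rewrite !scalerDr addrACA -scalerDl subrKC scale1r => H.
  apply: le_trans (_ : t * (g (x + v) - g x) + (1 - t) * (g (x + w) - g x) <= _).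
    by lra.
  by rewrite lerD // ler_pM2l // subr_gt0.
- by have := Lg x (x + w); rewrite opprD addNKr normrN; lra.
exists a; split=> // u.
by have := aC _ _ (lexx (g (x + u) - g x)); lra.
Qed.

End BoundedFunctionals.

(** * Separability of the dual ball on a separable subspace of an Asplund space *)

Section DualSeparability.
Context {R : realType} {X : normedModType R}.
Implicit Types (a b : X -> R) (Y : set X).

Definition is_subspace Y :=
  Y 0 /\ forall (s : R) x y, Y x -> Y y -> Y (s *: x + y).

Lemma subspaceZ {Y} (sY : is_subspace Y) (s : R) x : Y x -> Y (s *: x).
Proof. by move=> Yx; have := sY.2 s x 0 Yx sY.1; rewrite addr0. Qed.

Lemma subspaceD {Y} (sY : is_subspace Y) x y : Y x -> Y y -> Y (x + y).
Proof. by move=> Yx Yy; have := sY.2 1 x y Yx Yy; rewrite scale1r. Qed.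

Lemma subspaceN {Y} (sY : is_subspace Y) x : Y x -> Y (- x).
Proof. by move=> Yx; rewrite -scaleN1r; exact: subspaceZ. Qed.

Lemma lipschitz_const_continuous {L : R} {g : X -> R} :
  lipschitz_const L g -> continuous g.
Proof.
move=> Lg x; apply/cvgrPdist_le => e e0; near=> y.
have xy : `|x - y| <= e / (`|L| + 1).
  near: y; apply: cvgr_dist_le; first exact: cvg_id.
  by rewrite divr_gt0 // ltr_pwDr.
have LL : L * `|x - y| <= e.
  apply: le_trans (_ : (`|L| + 1) * `|x - y| <= _).
    by rewrite ler_wpM2r // ler_wpDr // ler_norm.
  by rewrite mulrC -ler_pdivlMr // ltr_pwDr.
have := Lg x y; have := Lg y x; rewrite distrC => ? ?.
by rewrite ler_norml; apply/andP; split; lra.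
Unshelve. all: by end_near. Qed.

(** The upper estimate at a point of differentiability is what forces every functional below [p]
    that almost attains [p x] to be close to the derivative. *)
Lemma asplund_sublinear {p : X -> R} : asplund X -> sublinear p ->
  (forall x, p x <= `|x|) ->
  exists x b, linear_fun b /\ forall e : R, 0 < e ->
    exists2 d : R, 0 < d &
      forall u, `|u| <= d -> p (x + u) <= p x + b u + e * `|u|.
Proof.
move=> aX sp pN.
have Lp : lipschitz_const 1 p.
  move=> x y; have := sp.1 y (x - y); rewrite subrKC => /le_trans; apply.
  by rewrite lerD2l mul1r.
have [|x y t _ _|||D [_ [DT Dd]]] := aX setT p.
- exact: openT.
- by [].
- exact/continuous_subspaceT/(lipschitz_const_continuous Lp).
- move=> x y t _ _ /andP[t0 t1]; apply: le_trans (sp.1 _ _) _.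
  by rewrite lerD // sp.2 // subr_ge0.
(* The closure of [D] contains 0, so [D] has a point. *)
have [x [Dx _]] := DT 0 I setT (@filterT _ (nbhs (0 : X)) _).
have [b lb E] : exists2 b : X -> R, linear_fun b &
    p \o shift x = cst (p x) + b +o_ (0 : X) id.
  exists ('d p x); first by move=> s y z; rewrite linearP.
  exact: ((diff_locallyP _ _).1 (Dd _ Dx)).2.
exists x, b; split=> // e e0.
have /eqaddoP/(_ e e0)/nbhs_ballP[d /= d0 dB] := E.
exists (d / 2) => [|u ud]; first by rewrite divr_gt0.
have /dB /= : ball (0 : X) d u.
  by rewrite -ball_normE /= sub0r normrN; apply: le_lt_trans ud _; lra.
by rewrite ler_norml !fctE /= [u + x]addrC => /andP[_]; lra.
Qed.

(** Covering by countably many balls of radius [e] for the dual norm of the restrictions to [Y]; the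
    centres may lie outside [B]. *)
Definition countably_covered Y (e : R) (B : set (X -> R)) :=
  exists c : nat -> X -> R, (forall n, dual_ball 1 (c n)) /\
    forall a, B a -> exists n, forall y, Y y -> `|a y - c n y| <= e * `|y|.

Lemma dual_ball0 : dual_ball 1 (fun _ : X => 0 : R).
Proof. by split=> [s x y|x]; rewrite ?mulr0 ?addr0 // normr0 mul1r. Qed.

Lemma countably_coveredS Y e B C : B `<=` C ->
  countably_covered Y e C -> countably_covered Y e B.
Proof. by move=> BC [c [c1 cC]]; exists c; split=> // a /BC; exact: cC. Qed.

Lemma countably_covered0 Y e B : ~ (B !=set0) -> countably_covered Y e B.
Proof.
by move=> B0; exists (fun _ _ => 0); split=> [_|a Ba]; [exact: dual_ball0|case: B0; exists a].
Qed.

Lemma countably_covered_bigcup {Y e} {T : countType} {B : T -> set (X -> R)} :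
  (forall i, countably_covered Y e (B i)) ->
  countably_covered Y e (\bigcup_i B i).
Proof.
move=> /choice[c cP].
exists (fun n => if unpickle n is Some (i, m) then c i m else fun=> 0); split.
  by move=> n; case: unpickle => [[i m]|]; [exact: (cP i).1|exact: dual_ball0].
move=> a [i _ Ba]; have [m Hm] := (cP i).2 _ Ba.
by exists (pickle (i, m)); rewrite pickleK.
Qed.

(* Otherwise let [A] be what is left of the dual ball after removing all countably
   covered half-space slices by points of [D]: no slice of [A] by a point of [Y]
   has radius at most [e].  Extend the support function of [A] on [Y] to a minimal
   sublinear [p] on the whole space.  Cutting off the slice of [p] at a point of
   differentiability must be felt on [Y] by minimality, and there it exposes a
   slice of [A] of diameter at most [e]. *)
Lemma dual_ball_covered {Y} (D : nat -> X) (e : R) : asplund X -> is_subspace Y ->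
  (forall n, Y (D n)) ->
  (forall y (d : R), Y y -> 0 < d -> exists n, `|y - D n| < d) ->
  0 < e -> countably_covered Y e (dual_ball 1).
Proof.
move=> aX sY YD dD e0; apply: contrapT => ncov.
pose S (i : nat * rat) : set (X -> R) :=
  [set a | dual_ball 1 a /\ ratr i.2 < a (D i.1)].
pose B i : set (X -> R) := [set a | S i a /\ countably_covered Y e (S i)].
have Bcov : countably_covered Y e (\bigcup_i B i).
  apply: countably_covered_bigcup => i.
  have [ci|nci] := pselect (countably_covered Y e (S i)).
    by apply: countably_coveredS ci => a [].
  by apply: countably_covered0 => -[a []].
pose A := dual_ball 1 `\` \bigcup_i B i.
have [a1 Aa1] : A !=set0.
  apply: contrapT => A0; apply: ncov; apply: countably_coveredS Bcov => a ba.
  by apply: contrapT => nB; apply: A0; exists a.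
have AN a y : A a -> a y <= `|y|.
  by move=> Aa; have := dual_ball_le Aa.1 (x := y); rewrite mul1r.
pose q y := sup [set a y | a in A].
have Aq a y : A a -> a y <= q y.
  move=> Aa; apply: ub_le_sup; last by exists a.
  by exists `|y| => _ [b Ab <-]; exact: AN.
have qN y : Y y -> q y <= 1 * `|y|.
  move=> _; rewrite mul1r; apply: ge_sup; first by exists (a1 y), a1.
  by move=> _ [b Ab <-]; exact: AN.
have q0 : 0 <= q 0 by rewrite -[X in X <= _](linear_fun0 Aa1.1.1); exact: Aq.
have [p [sp pN qp pmin]] := minimal_sublinear Y q (norm_sublinear ler01) qN.
have pN' x : p x <= `|x| by rewrite -[leRHS]mul1r.
have [x [b [lb bx]]] := asplund_sublinear aX sp pN'.
have [|d d0 {}bx] := bx (e / 4); first by rewrite divr_gt0.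
(* If [a' <= p] and [a' x > p x - h], then on the sphere of radius [d] the difference [a' - b] is at
   most [d * (e / 4) + h = d * (e / 2)]. *)
pose h := d * (e / 4).
have h0 : 0 < h by rewrite mulr_gt0 // divr_gt0.
(* Otherwise the constraint [a x <= p x - h] could be imposed on [p] while staying above [q] on [Y],
   against minimality. *)
have [y [t [t0 Yy yq]]] : exists y t,
    [/\ 0 <= t, Y y & p (y - t *: x) + t * (p x - h) < q y].
  apply: contrapT => H.
  have {}H y t : 0 <= t -> Y y -> q y <= p (y - t *: x) + t * (p x - h).
    by move=> t0 Yy; rewrite leNgt; apply/negP => ?; apply: H; exists y, t.
  pose K v r := exists t : R, [/\ 0 <= t, v = t *: x & r = t * (p x - h)].
  have cK : is_cone K.
    split=> [|v w r s [t [t0 -> ->]] [u [u0 -> ->]]|t v r t0 [u [u0 -> ->]]].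
    - by exists 0; split; rewrite ?scale0r ?mul0r.
    - by exists (t + u); split; rewrite ?addr_ge0 // ?scalerDl ?mulrDl.
    - exists (t * u); split; rewrite ?scalerA ?mulrA //.
      by rewrite mulr_ge0 // ltW.
  have Kp w r : K w r -> 0 <= r + p (- w).
    move=> [t [t0 -> ->]]; have := H 0 t t0 sY.1.
    by rewrite sub0r addrC => H0; exact: le_trans q0 H0.
  have [K00 _ _] := cK.
  have Kx : K x (p x - h) by exists 1; split; rewrite ?scale1r ?mul1r.
  have := pmin _ (cone_inf_sublinear sp cK Kp) _ _ x.
  have := cone_inf_le sp Kp x _ _ Kx; rewrite subrr (sublinear0 sp) addr0.
  move=> H1 H2; suff : p x <= cone_inf p K x by lra.
  apply: H2 => [z|z Yz].
    by have := cone_inf_le sp Kp z _ _ K00; rewrite subr0 add0r.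
  by apply: cone_inf_ge => // w r [u [u0 -> ->]]; rewrite addrC; exact: H.
pose beta := p (y - t *: x) + t * (p x - h).
(* On [Y] one has [a <= q <= p], so [a] extends from [Y] to some [a' <= p]; then [beta < a y] forces
   [a' x > p x - h], and [a'] is close to [b]. *)
have slice a : A a -> beta < a y ->
    forall z, Y z -> `|a z - b z| <= e / 2 * `|z|.
  move=> Aa ya z0 Yz0.
  have la : linear_fun a := Aa.1.1.
  pose K v r := Y v /\ r = a v.
  have [||a' [la' a'p a'K]] := hahn_banach_cone K sp.
  - split=> [|v w r s [Yv ->] [Yw ->]|s v r s0 [Yv ->]].
    + by split; [exact: sY.1|rewrite linear_fun0].
    + by split; [exact: subspaceD|rewrite linear_funD].
    + by split; [exact: subspaceZ|rewrite linear_funZ].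
  - move=> w r [Yw ->]; rewrite -[a w]opprK -(linear_funN la) addrC subr_ge0.
    apply: le_trans (Aq _ _ Aa) _; apply: qp; exact: subspaceN.
  have a'E z : Y z -> a' z = a z.
    move=> Yz; apply/eqP; rewrite eq_le; apply/andP; split.
      by apply: a'K; split.
    have : a' (- z) <= a (- z) by apply: a'K; split; first exact: subspaceN.
    by rewrite !linear_funN // lerN2.
  have a'x : p x - h < a' x.
    have := a'p (y - t *: x); rewrite linear_funB // linear_funZ // (a'E y Yy).
    move=> H1; have : t * (p x - h) < t * a' x by move: ya; rewrite /beta; lra.
    rewrite ltNge => H2; rewrite ltNge; apply/negP => H3.
    by move/negP: H2; apply; rewrite ler_wpM2l.
  have bound z : a' z - b z <= e / 2 * `|z|.
    have [->|zn0] := eqVneq z 0.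
      by rewrite (linear_fun0 la') (linear_fun0 lb) subrr normr0 mulr0.
    have z0' : 0 < `|z| by rewrite normr_gt0.
    pose u := (d / `|z|) *: z.
    have uN : `|u| = d.
      by rewrite normrZ ger0_norm ?divfK ?gt_eqF // divr_ge0 // ltW.
    have := bx u; rewrite uN => /(_ (lexx _)).
    have := a'p (x + u); rewrite (linear_funD la') => H1 H2.
    have : a' u - b u <= e / 2 * d by move: a'x; rewrite /h; lra.
    rewrite (linear_funZ la') (linear_funZ lb) -mulrBr mulrAC ler_pdivrMr // mulrC.
    by rewrite [e / 2 * d * _]mulrAC ler_pM2r.
  rewrite -a'E // ler_norml bound andbT.
  by have := bound (- z0); rewrite (linear_funN la') (linear_funN lb) normrN; lra.
have [_ [a0 Aa0 <-] a0y] : exists2 r, [set a y | a in A] r & beta < r.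
  by apply: sup_gt => //; exists (a1 y), a1.
pose gap := a0 y - beta.
have gap0 : 0 < gap by rewrite subr_gt0.
have [m ym] := dD y (gap / 4) Yy (divr_gt0 gap0 (ltr0n _ 4)).
have near1 a : dual_ball 1 a -> `|a y - a (D m)| < gap / 4.
  move=> [la aN]; rewrite -linear_funB //; apply: le_lt_trans (aN _) _.
  by rewrite mul1r.
(* Replacing [y] by [D m] costs less than [gap / 4]: the slice at level [r] still contains [a0], and
   its members still exceed [beta] at [y]. *)
have [r] : exists r : rat, ratr r \in `]beta + gap / 4, beta + 3 * gap / 4[.
  by apply: rat_in_itvoo; lra.
rewrite in_itv /= => /andP[r1 r2].
have Sa0 : S (m, r) a0.
  split; first exact: Aa0.1.
  by have := near1 _ Aa0.1; rewrite ltr_norml /gap /= in r2 *; move=> /andP[? ?]; lra.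
have ncS : ~ countably_covered Y e (S (m, r)).
  by move=> cS; apply: Aa0.2; exists (m, r).
apply: ncS.
pose C (i : bool) : set (X -> R) := if i then \bigcup_i B i else A `&` S (m, r).
have : countably_covered Y e (\bigcup_i C i).
  apply: countably_covered_bigcup => -[] //=.
  (* Both [a] and [a0] are within [e / 2] of [b] on [Y]; the centre is [a0], which is known to lie
     in the dual ball. *)
  exists (fun=> a0); split=> [_|a [Aa [_ Sa]]]; first exact: Aa0.1.
  exists 0%N => z Yz.
  have ya : beta < a y.
    by have := near1 _ Aa.1; rewrite ltr_norml /= in Sa *; move=> /andP[? ?]; lra.
  have := slice _ Aa ya z Yz; have := slice _ Aa0 a0y z Yz.
  rewrite !ler_norml => /andP[? ?] /andP[? ?]; apply/andP; split; lra.
apply: countably_coveredS => a Sa.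
have [Ba|nBa] := pselect ((\bigcup_i B i) a); first by exists true.
by exists false => //; split=> //; split=> //; exact: Sa.1.
Qed.

Lemma dual_ball_dense {Y} (D : nat -> X) : asplund X -> is_subspace Y ->
  (forall n, Y (D n)) ->
  (forall y (d : R), Y y -> 0 < d -> exists n, `|y - D n| < d) ->
  exists c : nat -> X -> R, (forall n, dual_ball 1 (c n)) /\
    forall a (e : R), dual_ball 1 a -> 0 < e ->
      exists n, forall y, Y y -> `|a y - c n y| <= e * `|y|.
Proof.
move=> aX sY YD dD.
have /choice[c cP] (k : nat) : countably_covered Y k.+1%:R^-1 (dual_ball 1).
  by apply: dual_ball_covered dD _.
exists (fun n => if unpickle n is Some (i, m) then c i m else fun=> 0); split.
  by move=> n; case: unpickle => [[i m]|]; [exact: (cP i).1|exact: dual_ball0].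
move=> a e a1 e0.
have [k ke] : exists k : nat, k.+1%:R^-1 < e.
  have [k _ /(_ _ (leqnn k)) /=] := near_infty_natSinv_lt (PosNum e0).
  by exists k.
have [m Hm] := (cP k).2 _ a1.
exists (pickle (k, m)); rewrite pickleK => y /Hm /le_trans; apply.
by rewrite ler_wpM2r // ltW.
Qed.

End DualSeparability.

(** * A smooth convex approximation of the norm *)

Section SmoothApproximation.
Context {R : realType} {X : normedModType R}.
Implicit Types (a : X -> R) (Y : set X).

(** [u |-> a u *: x] projects [Y] onto a line along the kernel of [a]. The norm of [a] on [Y] need
    not be attained, so [x] is a multiple of a vector attaining more than half of it, whence the
    factor 2; if [a] vanishes on [Y], then [x = 0]. *)
Lemma dual_ball_projection {Y a} : is_subspace Y -> dual_ball 1 a ->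
  exists x, [/\ Y x, forall u, Y u -> `|a u| * `|x| <= 2 * `|u|
    & forall u, Y u -> a (u - a u *: x) = 0].
Proof.
move=> sY [la aN].
have [[u1 [Yu1 au1]]|a0] := pselect (exists u, Y u /\ a u != 0); last first.
  have {}a0 u : Y u -> a u = 0.
    by move=> Yu; apply/eqP; apply: contrapT => /negP ?; apply: a0; exists u.
  exists 0; split=> [|u Yu|u Yu]; first exact: sY.1.
    by rewrite normr0 mulr0 mulr_ge0.
  by rewrite scaler0 subr0 a0.
pose V := [set z | exists u, [/\ Y u, `|u| <= 1 & z = `|a u|]].
have V1 : has_ubound V.
  exists 1 => _ [u [Yu ule1 ->]].
  by apply: le_trans (aN u) _; rewrite mul1r.
have supV u : Y u -> `|a u| <= sup V * `|u|.
  move=> Yu; have [->|un0] := eqVneq u 0.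
    by rewrite (linear_fun0 la) !normr0 mulr0.
  have u0 : 0 < `|u| by rewrite normr_gt0.
  rewrite -ler_pdivrMr //; apply: ub_le_sup => //.
  exists (`|u|^-1 *: u); split; first exact: subspaceZ.
    by rewrite normrZ normfV normr_id mulVf // gt_eqF.
  by rewrite (linear_funZ la) normrM normfV normr_id mulrC.
have s0 : 0 < sup V.
  have := supV _ Yu1; rewrite leNgt => /negP H; rewrite ltNge; apply/negP => H'.
  by apply: H; apply: le_lt_trans (_ : 0 < _); rewrite ?normr_gt0 // mulr_le0_ge0.
have [_ [u [Yu ule1 ->]] au] : exists2 z, V z & sup V / 2 < z.
  apply: sup_gt; last by lra.
  by exists `|a 0|, 0; rewrite normr0; split=> //; exact: sY.1.
have aun0 : a u != 0 by rewrite -normr_gt0; lra.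
exists ((a u)^-1 *: u); split=> [|v Yv|v Yv]; first exact: subspaceZ.
  rewrite normrZ normfV mulrA.
  have au0 : 0 < `|a u| by rewrite normr_gt0.
  apply: le_trans (_ : `|a v| / `|a u| <= _).
    by rewrite ler_piMr // divr_ge0.
  rewrite ler_pdivrMr //; apply: le_trans (supV _ Yv) _.
  rewrite -mulrA mulrCA mulrC ler_wpM2l //; lra.
by rewrite (linear_funB la) !(linear_funZ la) mulVf // mulr1 subrr.
Qed.

(** For convex [g] this is Fréchet differentiability in the directions of [Y]; second differences
    avoid naming a derivative and behave well under sums. *)
Definition smooth_along Y (g : X -> R) := forall z (e : R), 0 < e ->
  exists2 d : R, 0 < d & forall u, Y u -> `|u| <= d ->
    g (z + u) + g (z - u) - 2 * g z <= e * `|u|.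

Lemma sqr_convex (s a b t : R) : 0 <= t <= 1 -> 0 <= s ->
  s <= t * a + (1 - t) * b -> s ^+ 2 <= t * a ^+ 2 + (1 - t) * b ^+ 2.
Proof.
move=> /andP[t0 t1] s0 sab.
apply: le_trans (_ : (t * a + (1 - t) * b) ^+ 2 <= _).
  by rewrite ler_sqr // nnegrE (le_trans s0).
rewrite -subr_ge0.
have -> : t * a ^+ 2 + (1 - t) * b ^+ 2 - (t * a + (1 - t) * b) ^+ 2 =
  t * (1 - t) * (a - b) ^+ 2 by ring.
by rewrite mulr_ge0 ?sqr_ge0 // mulr_ge0 // subr_ge0.
Qed.

Definition approx_norm (rho : R) (g : X -> R) :=
  [/\ g 0 = 0, forall z, 0 <= g z, forall z, `|z| - rho <= g z,
      lipschitz_const 1 g & convex_on setT g].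

Section Construction.
Context (Y : set X) (c : nat -> X -> R) (x : nat -> X) (rho : R).
Context (sY : is_subspace Y) (c1 : forall n, dual_ball 1 (c n))
  (cdense : forall a (e : R), dual_ball 1 a -> 0 < e ->
     exists n, forall y, Y y -> `|a y - c n y| <= e * `|y|)
  (Yx : forall n, Y (x n))
  (cx : forall n u, Y u -> `|c n u| * `|x n| <= 2 * `|u|)
  (cP : forall n u, Y u -> c n (u - c n u *: x n) = 0)
  (rho0 : 0 < rho).

Let P n u := u - c n u *: x n.
Let E n u := (`|c n u| * `|x n|) ^+ 2 + `|P n u| ^+ 2.
(** This weight gives [s <= b n * s ^+ 2 + rho / 2 ^+ n.+2]; used for both parts of each component,
    the errors sum up to less than [rho]. *)
Let b n := 2 ^+ n / rho.

Let lc n : linear_fun (c n) := (c1 n).1.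

Let b_gt0 n : 0 < b n.
Proof. by rewrite divr_gt0 // exprn_gt0. Qed.

Let PD n u v : P n (u + v) = P n u + P n v.
Proof. by rewrite /P (linear_funD (lc n)) scalerDl opprD addrACA. Qed.

Let PZ n s u : P n (s *: u) = s *: P n u.
Proof. by rewrite /P (linear_funZ (lc n)) scalerBr scalerA. Qed.

Let PN n u : P n (- u) = - P n u.
Proof. by rewrite -scaleN1r PZ scaleN1r. Qed.

Let YP n u : Y u -> Y (P n u).
Proof. by move=> Yu; apply: subspaceD => //; apply: subspaceN => //; exact: subspaceZ. Qed.

Let P_norm n u : Y u -> `|P n u| <= 3 * `|u|.
Proof.
move=> Yu; apply: le_trans (ler_normB _ _) _; rewrite normrZ.
by have := cx n _ Yu; lra.
Qed.

Let E_ge0 n u : 0 <= E n u.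
Proof. by rewrite addr_ge0 ?sqr_ge0. Qed.

Let E0 n : E n 0 = 0.
Proof.
by rewrite /E /P (linear_fun0 (lc n)) scale0r subrr !normr0 mul0r expr0n /= addr0.
Qed.

Let E_convex n (t : R) u v : 0 <= t <= 1 ->
  E n (t *: u + (1 - t) *: v) <= t * E n u + (1 - t) * E n v.
Proof.
move=> t01; have /andP[t0 t1] := t01; have t1' : 0 <= 1 - t by rewrite subr_ge0.
rewrite /E !mulrDr addrACA lerD //; apply: sqr_convex => //.
- rewrite !mulrA -mulrDl ler_wpM2r // (linear_funD (lc n)) !(linear_funZ (lc n)).
  by apply: le_trans (ler_normD _ _) _; rewrite !normrM ger0_norm // (ger0_norm t1').
- rewrite PD !PZ; apply: le_trans (ler_normD _ _) _.
  by rewrite !normrZ ger0_norm // (ger0_norm t1').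
Qed.

(** The part along [x n] is the square of a scalar, with second difference at most [8 * |u|^2]. The
    kernel part involves the arbitrary norm and gives [12 * |P n y| * |u| + 18 * |u|^2], so [E n] is
    almost smooth only where [P n y] is small. *)
Let E_second n y u : Y u ->
  E n (y + u) + E n (y - u) - 2 * E n y <= 26 * `|u| ^+ 2 + 12 * `|P n y| * `|u|.
Proof.
move=> Yu; rewrite /E !PD PN (linear_funB (lc n)) (linear_funD (lc n)).
have Pu := P_norm n _ Yu; have cu := cx n _ Yu.
have sq s : (`|s| * `|x n|) ^+ 2 = s ^+ 2 * `|x n| ^+ 2.
  by rewrite exprMn real_normK // num_real.
have H1 : (`|c n u| * `|x n|) ^+ 2 <= 4 * `|u| ^+ 2.
  rewrite (_ : 4 * _ = (2 * `|u|) ^+ 2); last by ring.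
  by rewrite ler_sqr ?nnegrE ?mulr_ge0.
have H2 : `|P n y + P n u| ^+ 2 <= (`|P n y| + `|P n u|) ^+ 2.
  by rewrite ler_sqr ?nnegrE ?addr_ge0 // ler_normD.
have H3 : `|P n y - P n u| ^+ 2 <= (`|P n y| + `|P n u|) ^+ 2.
  by rewrite ler_sqr ?nnegrE ?addr_ge0 // ler_normB.
have H4 : `|P n u| ^+ 2 <= 9 * `|u| ^+ 2.
  rewrite (_ : 9 * _ = (3 * `|u|) ^+ 2); last by ring.
  by rewrite ler_sqr ?nnegrE ?mulr_ge0.
have H5 : `|P n y| * `|P n u| <= 3 * (`|P n y| * `|u|).
  by rewrite mulrCA ler_wpM2l.
move: H1; rewrite !sq; lra.
Qed.

(** Asking for every [M >= N] makes [y] vanish from [N] on without fixing a length, so that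
    decompositions can be combined termwise. *)
Let decomp v r := exists (y : nat -> X) N, (forall i, Y (y i)) /\
  forall M, (N <= M)%N ->
    v = \sum_(0 <= i < M) y i /\ \sum_(0 <= i < M) b i * E i (y i) <= r.

Let decomp0 : decomp 0 0.
Proof.
exists (fun=> 0), 0%N; split=> [_|M _]; first exact: sY.1.
by rewrite !big1 // => i _; rewrite E0 mulr0.
Qed.

Let decomp_convex v w r s (t : R) : 0 <= t <= 1 -> decomp v r -> decomp w s ->
  decomp (t *: v + (1 - t) *: w) (t * r + (1 - t) * s).
Proof.
move=> t01 [y [N [Yy yN]]] [z [K [Yz zK]]]; have /andP[t0 t1] := t01.
exists (fun i => t *: y i + (1 - t) *: z i), (maxn N K); split=> [i|M].
  by apply: subspaceD => //; exact: subspaceZ.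
rewrite geq_max => /andP[NM KM].
have [-> r1] := yN _ NM; have [-> s1] := zK _ KM; split.
  by rewrite !scaler_sumr -big_split.
apply: le_trans (_ : t * (\sum_(0 <= i < M) b i * E i (y i)) +
  (1 - t) * (\sum_(0 <= i < M) b i * E i (z i)) <= _); last first.
  by rewrite lerD // ler_wpM2l // subr_ge0.
rewrite !mulr_sumr -big_split /=; apply: ler_sum => i _.
by rewrite mulrCA [(1 - t) * _]mulrCA -mulrDr ler_wpM2l ?(ltW (b_gt0 i)) // E_convex.
Qed.

Let decomp_low v r : decomp v r -> 0 <= r /\ `|v| <= r + rho.
Proof.
move=> [y [N [Yy /(_ _ (leqnn N))[-> yr]]]]; split.
  apply: le_trans yr; apply: sumr_ge0 => i _.
  by rewrite mulr_ge0 // ltW.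
have geo : \sum_(0 <= i < N) (rho / 2 ^+ i.+1) = rho - rho / 2 ^+ N.
  elim: N {yr} => [|n IH]; first by rewrite big_nil expr0 divr1 subrr.
  rewrite big_nat_recr //= IH exprS; field.
  by rewrite expf_neq0.
apply: le_trans (_ : \sum_(0 <= i < N) (b i * E i (y i) + rho / 2 ^+ i.+1) <= _).
  apply: le_trans (ler_norm_sum _ _ _) _; apply: ler_sum => i _.
  rewrite -[y i in X in X <= _](subrK (c i (y i) *: x i)).
  apply: le_trans (ler_normD _ _) _; rewrite normrZ.
  have AB (s : R) : s <= b i * s ^+ 2 + rho / 2 ^+ i.+1 / 2.
    rewrite -subr_ge0 (_ : _ - _ = b i * (s - rho / 2 ^+ i.+1) ^+ 2).
      by rewrite mulr_ge0 ?sqr_ge0 // ltW.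
    rewrite /b [2 ^+ i.+1]exprS; have : 2 ^+ i != 0 :> R by rewrite expf_neq0.
    by move: (2 ^+ i) => k k0; field; rewrite k0 gt_eqF.
  have := AB `|P i (y i)|; have := AB (`|c i (y i)| * `|x i|).
  by rewrite /E /P; lra.
rewrite big_split /= geo lerD // lerBlDr lerDl divr_ge0 ?exprn_ge0 //; exact: ltW.
Qed.

Let decomp_component v r n : decomp v r -> exists2 y, Y y &
  forall u, Y u -> decomp (v + u) (r + b n * (E n (y + u) - E n y)).
Proof.
move=> [y [N [Yy yN]]]; exists (y n) => // u Yu.
exists (fun i => if i == n then y i + u else y i), (maxn N n.+1); split.
  by move=> i; case: eqP => // _; exact: subspaceD.
move=> M; rewrite geq_max => /andP[NM nM]; have [-> yr] := yN _ NM.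
split.
  rewrite [RHS]big_mkord big_mkord (bigD1 (Ordinal nM)) //=.
  rewrite [RHS](bigD1 (Ordinal nM)) //= eqxx addrAC.
  congr (_ + _); apply: eq_bigr => i; rewrite -(inj_eq val_inj) /= => /negPf ne.
  by rewrite ne.
rewrite big_mkord (bigD1 (Ordinal nM)) //= eqxx.
move: yr; rewrite big_mkord (bigD1 (Ordinal nM)) //= => yr.
rewrite (eq_bigr (fun i : 'I_M => b i * E i (y i))); first by lra.
by move=> i; rewrite -(inj_eq val_inj) /= => /negPf ->.
Qed.

(** The infimal convolution of the norm with all the functions [b n * E n] on [Y]. *)
Let theta z := inf [set s | exists v r, decomp v r /\ s = `|z - v| + r].

Let theta_le z v r : decomp v r -> theta z <= `|z - v| + r.
Proof.
move=> vr; apply: ge_inf; last by exists v, r.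
by exists 0 => _ [w [s [/decomp_low[s0 _] ->]]]; exact: addr_ge0.
Qed.

Let theta_ge z s : (forall v r, decomp v r -> s <= `|z - v| + r) -> s <= theta z.
Proof.
move=> H; apply: lb_le_inf; first by exists (`|z - 0| + 0), 0, 0.
by move=> _ [v [r [vr ->]]]; exact: H.
Qed.

Let theta_approx z (e : R) : 0 < e ->
  exists v r, decomp v r /\ `|z - v| + r < theta z + e.
Proof.
move=> e0; have [_ [v [r [vr ->]]] ?] : exists2 s,
    [set s | exists v r, decomp v r /\ s = `|z - v| + r] s & s < theta z + e.
  by apply: inf_lt; [exists (`|z - 0| + 0), 0, 0|rewrite ltrDl].
by exists v, r.
Qed.

Let theta0 z : 0 <= theta z.
Proof. by apply: theta_ge => v r /decomp_low[r0 _]; exact: addr_ge0. Qed.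

Let theta_lip : lipschitz_const 1 theta.
Proof.
move=> z w; rewrite mul1r -lerBlDr; apply: theta_ge => v r vr.
have := theta_le z _ _ vr; have := ler_normD (z - w) (w - v); rewrite subrKA; lra.
Qed.

Let theta_convex : convex_on setT theta.
Proof.
move=> z w t _ _ t01; apply/ler_addgt0Pr => e e0.
have [v [r [vr zv]]] := theta_approx z _ e0.
have [u [s [us wu]]] := theta_approx w _ e0.
apply: le_trans (theta_le _ _ _ (decomp_convex _ _ _ _ _ t01 vr us)) _.
have /andP[t0 t1] := t01; have t1' : 0 <= 1 - t by rewrite subr_ge0.
rewrite opprD addrACA -!scalerBr.
have := ler_normD (t *: (z - v)) ((1 - t) *: (w - u)).
rewrite !normrZ (ger0_norm t0) (ger0_norm t1').
have := ler_wpM2l t0 (ltW zv); have := ler_wpM2l t1' (ltW wu); lra.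
Qed.

(** Choose [n] so that [c n] is close on [Y] to a subgradient of [theta] at [z]. In an almost
    optimal decomposition of [z] the [n]-th component is then almost parallel to [x n], where [E n]
    is almost smooth; varying this component alone bounds the second difference of [theta]. *)
Let theta_smooth : smooth_along Y theta.
Proof.
move=> z e e0.
have [a [a1 az]] := convex_on_subgradient z ler01 theta_convex theta_lip.
(* The final bound is [(26 + 12 * 2 + 2) * k * |u|]: the two terms of [E_second] and twice [eta]. *)
pose k := e / 52; have k0 : 0 < k by rewrite divr_gt0.
have subBB (p q h : X) : p - h - (q - h) = p - q by rewrite opprB addrA subrK.
have [n nk] := cdense _ _ a1 k0.
have B0 := b_gt0 n; set B := b n in B0.
exists (k / B) => [|u Yu uk]; first exact: divr_gt0.
have [->|un0] := eqVneq u 0.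
  by rewrite addr0 subr0 normr0 mulr0; lra.
have u0 : 0 < `|u| by rewrite normr_gt0.
(* The decomposition may depend on [u], as the radius [k / B] does not. The first bound serves to
   get [B * |w| <= 2 * k], the second makes the error of order [|u|]. *)
pose eta := Num.min (k ^+ 2 / B) (k * `|u|).
have eta0 : 0 < eta by rewrite lt_min !(divr_gt0, mulr_gt0, exprn_gt0).
have [v [r [vr zv]]] := theta_approx z _ eta0.
have [y Yy yP] := decomp_component _ _ n vr.
pose w := P n y; have Yw : Y w by exact: YP.
(* Removing the component of [y] in the kernel of [c n] cannot decrease the cost
   by more than [a w + eta], and [a] is [k]-small on this kernel. *)
have Bw : B * `|w| ^+ 2 <= k * `|w| + eta.
  have cw : c n w = 0 by exact: cP.
  have := theta_le (z - w) _ _ (yP _ (subspaceN sY _ Yw)).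
  rewrite subBB.
  have -> : E n (y - w) = E n y - `|w| ^+ 2.
    have Pw : P n w = w by rewrite /P cw scale0r subr0.
    by rewrite /E (linear_funB (lc n)) cw subr0 PD PN Pw -/w subrr normr0 expr0n addr0 addrK.
  have := az (- w); rewrite (linear_funN a1.1).
  have := nk _ Yw; rewrite cw subr0 => /(le_trans (ler_norm _)).
  by rewrite -/B; lra.
have eta1 : B * eta <= k ^+ 2.
  by rewrite mulrC -ler_pdivlMr // ge_min lexx.
have {}Bw : B * `|w| <= 2 * k.
  rewrite leNgt; apply/negP => H.
  have H1 : (B * `|w|) ^+ 2 <= k * (B * `|w|) + k ^+ 2.
    have := ler_wpM2l (ltW B0) Bw; rewrite mulrDr.
    rewrite (_ : B * (B * `|w| ^+ 2) = (B * `|w|) ^+ 2); [lra|ring].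
  have H2 : 2 * k * (B * `|w|) < (B * `|w|) ^+ 2.
    by rewrite expr2 ltr_pM2r // (lt_trans _ H) // mulr_gt0.
  have : k * (2 * k) < k * (B * `|w|) by rewrite ltr_pM2l.
  have := exprn_gt0 2 k0; lra.
have Bu : B * `|u| <= k by rewrite mulrC -ler_pdivlMr.
have := theta_le (z + u) _ _ (yP _ Yu); have := subBB z v (- u); rewrite !opprK => ->.
have := theta_le (z - u) _ _ (yP _ (subspaceN sY _ Yu)); rewrite subBB => H1 H2.
have H3 := ler_wpM2l (ltW B0) (E_second n y _ Yu).
have H4 := ler_wpM2r (ltW u0) Bw.
have H5 := ler_wpM2r (ltW u0) Bu.
have eta2 : eta <= k * `|u| by rewrite ge_min lexx orbT.
have -> : e = 52 * k by rewrite /k mulrC divfK.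
move: H1 H2 H3; rewrite -/B -/w; lra.
Qed.

Lemma approx_norm_smooth : exists2 g, approx_norm rho g & smooth_along Y g.
Proof.
exists theta => //; split=> // [|z].
  apply/eqP; rewrite eq_le theta0 andbT.
  by have := theta_le 0 _ _ decomp0; rewrite subr0 normr0 addr0.
apply: theta_ge => v r /decomp_low[_ vr].
have := ler_normD (z - v) v; rewrite subrK; lra.
Qed.

End Construction.

Lemma exists_approx_norm {Y} (D : nat -> X) (rho : R) : asplund X ->
  is_subspace Y -> (forall n, Y (D n)) ->
  (forall y (d : R), Y y -> 0 < d -> exists n, `|y - D n| < d) -> 0 < rho ->
  exists2 g, approx_norm rho g & smooth_along Y g.
Proof.
move=> aX sY YD dD rho0.
have [c [c1 cdense]] := dual_ball_dense D aX sY YD dD.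
have /choice[x xP] n := dual_ball_projection sY (c1 n).
apply: (approx_norm_smooth Y c x rho) => // n; by have [] := xP n.
Qed.

End SmoothApproximation.

(** * Sums of series of convex Lipschitz functions *)

Section SupSeries.
Context {R : realType} {X : normedModType R}.
Implicit Types (g : X -> R) (Y : set X).

Lemma smooth_along_add {Y g h} :
  smooth_along Y g -> smooth_along Y h -> smooth_along Y (fun z => g z + h z).
Proof.
move=> sg sh z e e0.
have [d d0 dP] := sg z (e / 2) (divr_gt0 e0 (ltr0n _ 2)).
have [k k0 kP] := sh z (e / 2) (divr_gt0 e0 (ltr0n _ 2)).
exists (Num.min d k) => [|u Yu]; first by rewrite lt_min d0.
by rewrite le_min => /andP[/(dP _ Yu) ? /(kP _ Yu)]; lra.
Qed.

Lemma smooth_along_translate {Y g} (m : R) x : 0 < m ->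
  smooth_along Y g -> smooth_along Y (fun z => m * g (z - x)).
Proof.
move=> m0 sg z e e0; have [d d0 dP] := sg (z - x) (e / m) (divr_gt0 e0 m0).
exists d => // u Yu /(dP _ Yu) /=.
rewrite [z + u - x]addrAC [z - u - x]addrAC -(ler_pM2l m0).
by rewrite (mulrA m (e / m)) (mulrC m (e / m)) divfK ?gt_eqF //; lra.
Qed.

Lemma convex_on_translate {g} (m : R) x : 0 <= m ->
  convex_on setT g -> convex_on setT (fun z => m * g (z - x)).
Proof.
move=> m0 cg z w t _ _ t01.
have := ler_wpM2l m0 (cg (z - x) (w - x) t I I t01).
have -> : t *: (z - x) + (1 - t) *: (w - x) = t *: z + (1 - t) *: w - x.
  by rewrite !scalerBr addrACA -opprD -scalerDl subrKC scale1r.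
by lra.
Qed.

Context (h : nat -> X -> R) (x : nat -> X) (m T : nat -> R) (x0 : X) (M : R).
Context (h_ge0 : forall k z, 0 <= h k z)
  (h_convex : forall k, convex_on setT (h k))
  (h_lip : forall k, lipschitz_const (m k) (h k))
  (h_x : forall k, h k (x k) = 0)
  (xM : forall k, `|x k - x0| <= M)
  (m_ge0 : forall k, 0 <= m k)
  (mT : forall N K, (N <= K)%N -> \sum_(N <= k < K) m k <= T N).

Let S N z := \sum_(0 <= k < N) h k z.

(** The terms are nonnegative, so this supremum is the sum of the series. *)
Definition sup_series (z : X) : R := sup [set s | exists N, s = \sum_(0 <= k < N) h k z].

Let T_ge0 N : 0 <= T N.
Proof. by have := mT N N (leqnn N); rewrite big_geq. Qed.

Let S_split N K z : (N <= K)%N -> S K z = S N z + \sum_(N <= k < K) h k z.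
Proof. by move=> NK; rewrite /S (big_cat_nat (leq0n N) NK). Qed.

Let tail_lip N K z w : (N <= K)%N ->
  \sum_(N <= k < K) h k z <= \sum_(N <= k < K) h k w + T N * `|z - w|.
Proof.
move=> NK; apply: le_trans (_ : \sum_(N <= k < K) h k w +
    (\sum_(N <= k < K) m k) * `|z - w| <= _); last first.
  by rewrite lerD2l ler_wpM2r // mT.
by rewrite mulr_suml -big_split /=; apply: ler_sum => i _; exact: h_lip.
Qed.

Let tail_le N K z : (N <= K)%N ->
  \sum_(N <= k < K) h k z <= T N * (`|z - x0| + M).
Proof.
move=> NK; apply: le_trans (_ : (\sum_(N <= k < K) m k) * (`|z - x0| + M) <= _).
  rewrite mulr_suml; apply: ler_sum => i _.
  have := h_lip i z (x i); rewrite h_x add0r => /le_trans; apply.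
  rewrite ler_wpM2l //; have := ler_normB (z - x0) (x i - x0).
  by have := xM i; rewrite opprB addrA subrK; lra.
rewrite ler_wpM2r ?mT //.
by have := normr_ge0 (z - x0); have := le_trans (normr_ge0 _) (xM 0); lra.
Qed.

Lemma sup_series_ge N z : \sum_(0 <= k < N) h k z <= sup_series z.
Proof.
apply: ub_le_sup; last by exists N.
by exists (T 0 * (`|z - x0| + M)) => _ [K ->]; exact: tail_le.
Qed.

Let sup_series_leP z b : (forall N, S N z <= b) -> sup_series z <= b.
Proof.
move=> H; apply: ge_sup; first by exists (S 0 z), 0%N.
by move=> _ [N ->]; exact: H.
Qed.

Let S_mono N K z : (N <= K)%N -> S N z <= S K z.
Proof. by move=> NK; rewrite (S_split _ _ _ NK) lerDl sumr_ge0. Qed.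

Let sup_series_lePN N z b : (forall K, (N <= K)%N -> S K z <= b) -> sup_series z <= b.
Proof.
move=> H; apply: sup_series_leP => K.
exact: le_trans (S_mono _ _ z (leq_maxl K N)) (H _ (leq_maxr K N)).
Qed.

Lemma sup_series_le N z :
  sup_series z <= \sum_(0 <= k < N) h k z + T N * (`|z - x0| + M).
Proof.
apply: (sup_series_lePN N) => K NK.
by rewrite (S_split _ _ _ NK) lerD2l tail_le.
Qed.

Lemma sup_series_lip : lipschitz_const (T 0) sup_series.
Proof.
move=> z w; apply: sup_series_leP => N.
by apply: le_trans (tail_lip _ _ z w (leq0n N)) _; rewrite lerD2r sup_series_ge.
Qed.

Lemma sup_series_convex : convex_on setT sup_series.
Proof.
move=> z w t _ _ t01; apply: sup_series_leP => N; have /andP[t0 t1] := t01.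
apply: le_trans (_ : t * S N z + (1 - t) * S N w <= _); last first.
  by rewrite lerD // ler_wpM2l ?sup_series_ge // subr_ge0.
rewrite !mulr_sumr -big_split /=; apply: ler_sum => i _; exact: h_convex.
Qed.

(** A partial sum is smooth, and the tail is Lipschitz with constant [T N <= e / 4], which adds at
    most [e / 2 * |u|] to a second difference. *)
Lemma sup_series_smooth {Y} : (forall e : R, 0 < e -> exists N, T N <= e) ->
  (forall k, smooth_along Y (h k)) -> smooth_along Y sup_series.
Proof.
move=> T0 sh z e e0.
have [|N TN] := T0 (e / 4); first by rewrite divr_gt0.
have sS K : smooth_along Y (S K).
  elim: K => [|K IH].
    move=> p k k0; exists 1 => // u _ _.
    by rewrite /S !big_geq // mulr0 addr0 subr0 mulr_ge0 // ltW.
  have -> : S K.+1 = fun p => S K p + h K p.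
    by apply/funext => p; rewrite /S big_nat_recr.
  exact: smooth_along_add.
have [|d d0 dP] := sS N z (e / 2); first by rewrite divr_gt0.
exists d => // u Yu ud.
have step v : sup_series (z + v) <= sup_series z + (S N (z + v) - S N z) + T N * `|v|.
  apply: (sup_series_lePN N) => K NK.
  have := tail_lip _ _ (z + v) z NK; rewrite addrAC subrr add0r.
  have := sup_series_ge K z; rewrite -/(S K z) !(S_split _ _ _ NK); lra.
have := step u; have := step (- u); rewrite normrN.
have := ler_wpM2r (normr_ge0 u) TN; have := dP _ Yu ud; lra.
Qed.

End SupSeries.

(** * The smooth variational principle *)

Section VariationalPrinciple.
Context {R : realType} {X : completeNormedModType R}.
Implicit Types (F : X -> \bar R) (Y Z : set X).

Lemma lower_semicontinuous_le {F} y (b : R) : lower_semicontinuous F ->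
  (forall e : R, 0 < e -> exists2 z, `|y - z| < e & (F z <= (b + e)%:E)%E) ->
  (F y <= b%:E)%E.
Proof.
move=> lF H; rewrite leNgt; apply/negP => bF.
have [e e0 be] : exists2 e : R, 0 < e & ((b + e)%:E < F y)%E.
  case: (F y) bF => [r| |] //; last by exists 1; rewrite // ltry.
  rewrite lte_fin => br; exists ((r - b) / 2); first by rewrite divr_gt0 ?subr_gt0.
  by rewrite lte_fin; lra.
have [V Vy VF] := lF _ _ be.
have /nbhs_ballP[d /= d0 dV] := Vy.
have [|z yz Fz] := H (Num.min d e); first by rewrite lt_min d0.
move: yz; rewrite lt_min => /andP[yz _].
have /dV/VF : ball y d z by rewrite -ball_normE.
rewrite ltNge (le_trans Fz) // lee_fin lerD2l.
by rewrite ge_min lexx orbT.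
Qed.

Lemma half_pow_small (C e : R) : 0 < e -> exists k, C / 2 ^+ k.+1 <= e.
Proof.
move=> e0; have [k Ck] : exists k : nat, C / e <= k%:R.
  exists (Num.truncn `|C / e|).+1; apply: le_trans (ler_norm _) _.
  by apply: ltW; exact: truncnS_gt.
exists k; rewrite ler_pdivrMr ?exprn_gt0 // mulrC -ler_pdivrMr //.
apply: le_trans Ck _; rewrite -natrX ler_nat.
by apply: leq_trans (ltnW (ltn_expl k.+1 (ltnSn 1))).
Qed.

Lemma geometric_sum (a : R) (N K : nat) : (N <= K)%N ->
  \sum_(N <= k < K) a / 2 ^+ k = 2 * a / 2 ^+ N - 2 * a / 2 ^+ K.
Proof.
elim: K => [|K IH]; first by rewrite leqn0 => /eqP ->; rewrite big_geq // subrr.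
rewrite leq_eqVlt => /predU1P[->|NK]; first by rewrite big_geq // subrr.
rewrite big_nat_recr //= IH // [2 ^+ K.+1]exprS.
have : 2 ^+ K != 0 :> R by rewrite expf_neq0.
have : 2 ^+ N != 0 :> R by rewrite expf_neq0.
by move: (2 ^+ N) (2 ^+ K) => p q p0 q0; field; rewrite q0.
Qed.

Lemma geometric_cvg (x : nat -> X) (a : R) : 0 < a ->
  (forall k, `|x k.+2 - x k.+1| <= a / 2 ^+ k.+1) ->
  exists y, forall k, `|y - x k.+1| <= 2 * a / 2 ^+ k.+1.
Proof.
move=> a0 xa.
have dist k l : (k <= l)%N -> `|x l.+1 - x k.+1| <= 2 * a / 2 ^+ k.+1 - 2 * a / 2 ^+ l.+1.
  elim: l => [|l IH]; first by rewrite leqn0 => /eqP ->; rewrite !subrr normr0.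
  rewrite leq_eqVlt => /predU1P[->|kl]; first by rewrite !subrr normr0.
  have := IH kl; have := xa l; have := ler_normD (x l.+2 - x l.+1) (x l.+1 - x k.+1).
  rewrite subrKA; have -> : a / 2 ^+ l.+1 = 2 * a / 2 ^+ l.+2.
    rewrite [2 ^+ l.+2]exprS; have : 2 ^+ l.+1 != 0 :> R by rewrite expf_neq0.
    by move: (2 ^+ l.+1) => p p0; field.
  rewrite [2 * a / 2 ^+ l.+1](_ : _ = 2 * (2 * a / 2 ^+ l.+2)); first by lra.
  rewrite [2 ^+ l.+2]exprS; have : 2 ^+ l.+1 != 0 :> R by rewrite expf_neq0.
  by move: (2 ^+ l.+1) => p p0; field.
have dist' k l : (k <= l)%N -> `|x l.+1 - x k.+1| <= 2 * a / 2 ^+ k.+1.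
  move=> kl; apply: le_trans (dist _ _ kl) _.
  by rewrite gerBl divr_ge0 ?mulr_ge0 ?exprn_ge0 // ltW.
pose u k := x k.+1.
have cu : cauchy (u @ \oo).
  apply: cauchy_exP => e e0.
  have [k ke] := half_pow_small (2 * a) (e / 2) (divr_gt0 e0 (ltr0n _ 2)).
  exists (u k); exists k => // l /= kl; rewrite -ball_normE /= distrC.
  by apply: le_lt_trans (dist' _ _ kl) _; lra.
have /cauchy_cvg cu' := cu.
exists (lim (u @ \oo)) => k.
have : (fun l => `|u l - x k.+1|) @ \oo --> `|lim (u @ \oo) - x k.+1|.
  by apply: cvg_norm; apply: cvgB => //; exact: cvg_cst.
move=> cl; rewrite -(cvg_lim _ cl) //; apply: limr_le; first exact: cvgP cl.
by exists k => // l /= kl; exact: dist'.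
Qed.

Lemma weights_sum (c mu : R) N K : 0 <= c -> 0 <= mu -> (N <= K)%N ->
  \sum_(N <= k < K) (if k is 0%N then c else mu / 2 ^+ k) <=
  if N is 0%N then c + mu else 2 * mu / 2 ^+ N.
Proof.
move=> c0 mu0.
have pos n l : (n.+1 <= l)%N ->
    \sum_(n.+1 <= k < l) (if k is 0%N then c else mu / 2 ^+ k) <= 2 * mu / 2 ^+ n.+1.
  move=> nl. rewrite (@eq_big_nat _ _ _ _ _ _ (fun k => mu / 2 ^+ k)); last first.
    by case.
  rewrite geometric_sum //. 
  rewrite gerBl. apply: divr_ge0. 
  by rewrite mulr_ge0.
  by rewrite exprn_ge0.
case: N => [_|N NK]; last exact: pos.
case: K => [|K]; first by rewrite big_geq // addr_ge0.
rewrite big_ltn // lerD2l.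
have [->|K0] := posnP K; first by rewrite big_geq.
have := pos 0%N K.+1 isT.
by rewrite expr1 mulrC mulKf // pnatr_eq0.
Qed.

Lemma approx_minimizer {V : set X} {g : X -> R} p (e : R) : 0 < e ->
  (forall z, V z -> 0 <= g z) -> V p ->
  exists q, [/\ V q, forall z, V z -> g q <= g z + e & g q <= g p].
Proof.
move=> e0 g0 Vp.
have I0 : [set g z | z in V] !=set0 by exists (g p), p.
have Ile z : V z -> inf [set g z | z in V] <= g z.
  move=> Vz; apply: ge_inf; last by exists z.
  by exists 0 => _ [w Vw <-]; exact: g0.
have [gp|gp] := ltP (g p) (inf [set g z | z in V] + e).
  by exists p; split=> // z /Ile ?; lra.
have [_ [q Vq <-] gq] : exists2 s, [set g z | z in V] s &
    s < inf [set g z | z in V] + e by apply: inf_lt => //; rewrite ltrDl.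
by exists q; split=> // [z /Ile ?|]; lra.
Qed.

(* The Borwein-Preiss iteration, with the perturbations [m k * g_k (. - x k)]:
   the first weight is [c], the later ones sum up to [mu]. *)
Lemma variational_principle {F Y Z} x (c mu eta : R) :
  closed Y -> lower_semicontinuous F -> (forall z, 0 <= F z)%E ->
  Y x -> (F x < +oo)%E -> 0 < c -> 0 < mu -> 0 < eta ->
  (forall rho : R, 0 < rho -> exists2 g, approx_norm rho g & smooth_along Z g) ->
  exists y (h : X -> R),
    [/\ Y y, (F y + (c * `|y - x|)%:E <= F x + eta%:E)%E &
        forall z, Y z -> (F y + (h y)%:E <= F z + (h z)%:E)%E] /\
    [/\ lipschitz_const (c + mu) h, convex_on setT h & smooth_along Z h].
Proof.
move=> cY lF F0 Yx Fx c0 mu0 eta0 gauges.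
(* The first gauge has weight [c] and error [rho 0 = kappa / 2], so it costs only [eta / 2] in the
   bound on [F y + c * |y - x|]. *)
pose kappa := eta / c.
have kappa0 : 0 < kappa by rewrite divr_gt0.
have [c_ge0 mu_ge0 kappa_ge0] := And3 (ltW c0) (ltW mu0) (ltW kappa0).
have p2 k : 0 < 2 ^+ k :> R by rewrite exprn_gt0.
pose rho k : R := kappa / 2 ^+ k / 2.
have rho_gt0 k : 0 < rho k by rewrite !divr_gt0.
have /choice[theta thetaP] k : exists g, approx_norm (rho k) g /\ smooth_along Z g.
  by have [g ? ?] := gauges _ (rho_gt0 k); exists g.
pose m k : R := if k is 0%N then c else mu / 2 ^+ k.
have m_gt0 k : 0 < m k by case: k => //= k; rewrite divr_gt0.
pose T k : R := if k is 0%N then c + mu else 2 * mu / 2 ^+ k.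
have mT N K : (N <= K)%N -> \sum_(N <= k < K) m k <= T N.
  by apply: weights_sum; exact: ltW.
pose V : set X := [set z | Y z /\ (F z < +oo)%E].
pose fr z := fine (F z).
have frE z : V z -> F z = (fr z)%:E.
  by move=> [_ Fz]; rewrite /fr fineK // ge0_fin_numE.
have fr0 z : 0 <= fr z by exact: fine_ge0.
(* The hypotheses on the state stand inside the existential, so that choice yields a total function
   [next] that the iteration can call before they are proved. *)
have nextE (st : (X -> R) * X * nat) : exists q, (forall z, 0 <= st.1.1 z) -> V st.1.2 ->
    [/\ V q, forall z, V z -> fr q + st.1.1 q <= fr z + st.1.1 z + m st.2 * rho st.2
      & fr q + st.1.1 q <= fr st.1.2 + st.1.1 st.1.2].
  case: st => -[G p] k /=.
  have [[G0 Vp]|H] := pselect ((forall z, 0 <= G z) /\ V p); last first.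
    by exists p => G0 Vp; case: H.
  have [//||q Hq] := @approx_minimizer V (fun z => fr z + G z) p (m k * rho k) _ _ Vp.
  - exact: mulr_gt0.
  - by move=> z _; rewrite addr_ge0.
  - by exists q.
have [next nextP] := choice nextE.
pose st := fix st k : (X -> R) * X := if k is k'.+1 then
    let G' z := (st k').1 z + m k' * theta k' (z - (st k').2) in
    (G', next (G', (st k').2, k))
  else (fun=> 0, x).
pose xs k := (st k).2; pose G k := (st k).1.
pose h k z := m k * theta k (z - xs k).
have theta0 k : theta k 0 = 0 by have [[]] := thetaP k.
have theta_ge0 k z : 0 <= theta k z by have [[]] := thetaP k.
have theta_low k z : `|z| - rho k <= theta k z by have [[]] := thetaP k.
have theta_lip k : lipschitz_const 1 (theta k) by have [[]] := thetaP k.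
have h_ge0 k z : 0 <= h k z by rewrite mulr_ge0 // ltW.
have GS k z : G k.+1 z = G k z + h k z by [].
have GE k z : G k z = \sum_(0 <= j < k) h j z.
  by elim: k => [|k IH]; [rewrite big_geq|rewrite big_nat_recr //= -IH].
have G0 k z : 0 <= G k z by rewrite GE sumr_ge0.
have h_x k : h k (xs k) = 0 by rewrite /h subrr theta0 mulr0.
have Vxs k : V (xs k).
  by elim: k => [//|k IH]; have [] := nextP (G k.+1, xs k, k.+1) (G0 k.+1) IH.
have minS k z : V z ->
    fr (xs k.+1) + G k.+1 (xs k.+1) <= fr z + G k.+1 z + m k.+1 * rho k.+1.
  by have [_ H _] := nextP (G k.+1, xs k, k.+1) (G0 k.+1) (Vxs k); exact: H.
have decS k : fr (xs k.+1) + G k.+1 (xs k.+1) <= fr (xs k) + G k (xs k).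
  have [_ _] := nextP (G k.+1, xs k, k.+1) (G0 k.+1) (Vxs k).
  by move/le_trans; apply; rewrite /= GS h_x addr0.
have dec k : fr (xs k) + G k (xs k) <= fr x.
  by elim: k => [|k]; [rewrite GE big_geq // addr0|exact/le_trans/decS].
(* Almost minimality of [xs k.+1] and the decrease at the next stage give
   [h k.+1 (xs k.+2) <= m k.+1 * rho k.+1], so the move is at most [2 * rho k.+1]. The first move
   escapes this, as [x] is no approximate minimizer; hence the shifted indices. *)
have step k : `|xs k.+2 - xs k.+1| <= kappa / 2 ^+ k.+1.
  have hle : h k.+1 (xs k.+2) <= m k.+1 * rho k.+1.
    by have := minS k _ (Vxs k.+2); have := decS k.+1; rewrite !GS; lra.
  move: hle; rewrite /h ler_pM2l // => hle.
  have := theta_low k.+1 (xs k.+2 - xs k.+1); move: hle; rewrite /rho; lra.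
have [y yxs] := geometric_cvg _ _ kappa0 step.
pose M := `|y - x| + kappa.
have xsM k : `|xs k - x| <= M.
  case: k => [|k]; first by rewrite subrr normr0 addr_ge0 // ltW.
  have := yxs k; have := ler_normD (y - x) (xs k.+1 - y); rewrite addrC subrKA.
  rewrite [`|xs k.+1 - y|]distrC /M => H1 H2; apply: le_trans H1 _.
  rewrite lerD2l (le_trans H2) // ler_pdivrMr // [2 * kappa]mulrC ler_pM2l //.
  by rewrite exprS ler_peMr // exprn_ege1 // ler1n.
have h_lip k : lipschitz_const (m k) (h k).
  move=> z w; have := theta_lip k (z - xs k) (w - xs k).
  by rewrite opprB addrA subrK mul1r -(ler_pM2l (m_gt0 k)) mulrDr.
have h_cvx k : convex_on setT (h k).
  by apply: convex_on_translate; [exact: ltW|have [[]] := thetaP k].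
have h_smooth k : smooth_along Z (h k).
  by apply: smooth_along_translate => //; have [] := thetaP k.
have m_ge0 k : 0 <= m k by exact: ltW.
pose H := sup_series h.
have Hge k z : G k z <= H z.
  by rewrite GE; exact: (sup_series_ge h xs m T x M).
have Hle k z : H z <= G k z + T k * (`|z - x| + M).
  by rewrite GE; exact: (sup_series_le h xs m T x M).
have Hlip : lipschitz_const (c + mu) H.
  exact: (sup_series_lip h xs m T x M).
exists y, H; split; last first.
  split=> //; first exact: (sup_series_convex h xs m T x M).
  apply: (sup_series_smooth h xs m T x M) => // e e0.
  by have [k ke] := half_pow_small (2 * mu) e e0; exists k.+1.
have near_y (C b : R) : 0 <= C ->
    (forall k, fr (xs k.+1) <= b + C / 2 ^+ k.+1) -> (F y <= b%:E)%E.
  move=> C0 Hb; apply: lower_semicontinuous_le => // e e0.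
  have D0 : 0 <= 2 * kappa by rewrite mulr_ge0 // ltW.
  have [k ke] := half_pow_small (C + 2 * kappa) (e / 2) (divr_gt0 e0 (ltr0n _ 2)).
  have := divr_ge0 C0 (ltW (p2 k.+1)); have := divr_ge0 D0 (ltW (p2 k.+1)).
  move: ke; rewrite mulrDl => ke Dk Ck.
  exists (xs k.+1); first by have := yxs k; lra.
  by rewrite frE // lee_fin; have := Hb k; lra.
split.
- have closeY : closure Y y.
    move=> B /nbhs_ballP[d /= d0 dB].
    have [k ke] := half_pow_small (2 * kappa) (d / 2) (divr_gt0 d0 (ltr0n _ 2)).
    exists (xs k.+1); split; first by have [] := Vxs k.+1.
    by apply: dB; rewrite -ball_normE /=; have := yxs k; lra.
  by rewrite -(closure_id Y).1 // in closeY.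
- have Vx : V x by [].
  rewrite (frE _ Vx) -EFinD addeC -leeBrDl //.
  apply: (near_y (c * (2 * kappa))).
    by rewrite mulr_ge0 // mulr_ge0.
  move=> k; have := dec k.+1.
  have G1 : c * (`|xs k.+1 - x| - rho 0%N) <= G k.+1 (xs k.+1).
    apply: le_trans (_ : h 0%N (xs k.+1) <= _).
      by rewrite /h /= ler_pM2l // theta_low.
    by rewrite GE big_nat_recl // lerDl sumr_ge0.
  have : c * `|y - x| <= c * `|xs k.+1 - x| + c * (2 * kappa) / 2 ^+ k.+1.
    rewrite -mulrA -mulrDr ler_pM2l //.
    have := ler_normD (y - xs k.+1) (xs k.+1 - x); rewrite subrKA.
    by have := yxs k; lra.
  have crho : c * rho 0%N <= eta.
    by rewrite /rho /kappa expr0 divr1 mulrA mulrCA divff ?gt_eqF //; lra.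
  move: G1; rewrite mulrBr; lra.
- move=> z Yz; have [Vz|nVz] := pselect (V z); last first.
    have -> : F z = +oo%E.
      by apply/eqP; rewrite -leye_eq leNgt; apply/negP => ?; apply: nVz.
    by rewrite addye // leey.
  rewrite (frE _ Vz) -EFinD -leeBrDr //.
  (* Three errors of order [1 / 2 ^+ k.+1]: almost minimality of [xs k.+1], the tail of the series
     at [y], and the passage from [xs k.+1] to [y] in [G k.+1]. *)
  pose C := mu * kappa + 2 * mu * (`|y - x| + M) + (c + mu) * (2 * kappa).
  have M0 : 0 <= M := le_trans (normr_ge0 _) (xsM 0%N).
  apply: (near_y C) => [|k].
    have muk : 0 <= mu * kappa by exact: mulr_ge0.
    have myM : 0 <= 2 * mu * (`|y - x| + M) by rewrite mulr_ge0 ?addr_ge0 // mulr_ge0.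
    have cmk : 0 <= (c + mu) * (2 * kappa) by rewrite mulr_ge0 ?addr_ge0 // mulr_ge0.
    by rewrite /C; lra.
  have := minS k _ Vz; have := Hge k.+1 z; have := Hle k.+1 y.
  have : G k.+1 y <= G k.+1 (xs k.+1) + (c + mu) * `|y - xs k.+1|.
    rewrite !GE; apply: le_trans (_ : \sum_(0 <= j < k.+1)
        (h j (xs k.+1) + m j * `|y - xs k.+1|) <= _).
      by apply: ler_sum => j _; exact: h_lip.
    by rewrite big_split /= -mulr_suml lerD2l ler_wpM2r // (mT 0%N).
  have := ler_wpM2l (ltW (addr_gt0 c0 mu0)) (yxs k).
  have mr : m k.+1 * rho k.+1 <= mu * kappa / 2 ^+ k.+1.
    have i1 : (2 ^+ k.+1)^-1 <= 1 :> R by rewrite invf_le1 ?exprn_ege1 // ler1n.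
    have i0 : 0 <= (2 ^+ k.+1)^-1 :> R by rewrite invr_ge0 ltW.
    rewrite /m /rho; have : 0 <= mu * kappa by rewrite mulr_ge0 // ltW.
    set i := (2 ^+ k.+1)^-1 in i1 i0 * => mk0.
    have : mu * kappa * i * i <= mu * kappa * i.
      by rewrite ler_piMr // mulr_ge0.
    have : 0 <= mu * kappa * i * i by rewrite mulr_ge0 // mulr_ge0.
    rewrite (_ : mu * i * (kappa * i / 2) = mu * kappa * i * i / 2); last by ring.
    lra.
  have -> : T k.+1 = 2 * mu / 2 ^+ k.+1 by [].
  move: mr; rewrite /C; move: (m _ * rho _) (2 ^+ k.+1)^-1 => ? ?; lra.
Qed.

End VariationalPrinciple.

(** * Separable reduction of Fréchet subdifferentiability *)

Section SeparableReduction.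
Context {R : realType} {X : normedModType R}.
Implicit Types (F : X -> \bar R) (Y : set X).

(** Terms in the operations are finite trees, of which there are countably many; trees that are not
    binary evaluate to [x0]. *)
Lemma countable_closure_op (x0 : X) (op : nat -> X -> X -> X) :
  exists D : nat -> X, (exists n, D n = x0) /\
    forall i a b, exists n, D n = op i (D a) (D b).
Proof.
pose eval := fix eval (t : GenTree.tree nat) : X :=
  if t is GenTree.Node i [:: a; b] then op i (eval a) (eval b) else x0.
pose D n := if unpickle n is Some t then eval t else x0.
have evalD t : D (pickle t) = eval t by rewrite /D pickleK.
have Deval n : exists t, D n = eval t.
  by rewrite /D; case: unpickle => [t|]; [exists t|exists (GenTree.Leaf 0%N)].
exists D; split; first by exists (pickle (GenTree.Leaf 0%N)); rewrite evalD.
move=> i a b; have [s ->] := Deval a; have [t ->] := Deval b.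
by exists (pickle (GenTree.Node i [:: s; t])); rewrite evalD.
Qed.

Lemma closure_rangeP (D : nat -> X) y :
  closure (range D) y <-> forall e : R, 0 < e -> exists n, `|y - D n| < e.
Proof.
split=> [cy e e0|H B /nbhs_ballP[d /= d0 dB]].
  have [_ [[n _ <-] yn]] := cy _ (nbhsx_ballx y e e0).
  by exists n; rewrite -ball_normE in yn.
have [n yn] := H d d0; exists (D n); split; first by exists n.
by apply: dB; rewrite -ball_normE.
Qed.

Lemma closure_range_subspace (D : nat -> X) :
  (forall (q : rat) i j, exists n, D n = ratr q *: D i + D j) ->
  is_subspace (closure (range D)).
Proof.
move=> Dq; split.
  apply/closure_rangeP => e e0; have [n nE] := Dq (-1) 0%N 0%N.
  exists n; rewrite nE; have -> : ratr (-1) = -1 :> R by rewrite rmorphN1.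
  by rewrite scaleN1r addNr subrr normr0.
move=> s x y /closure_rangeP Yx /closure_rangeP Yy.
apply/closure_rangeP => e e0.
have x1 : 0 < `|x| + 1 by rewrite ltr_wpDl.
have s2 : 0 < `|s| + 1 by rewrite ltr_wpDl.
have [i xi] := Yx (e / 3 / (`|s| + 1)) ltac:(by rewrite !divr_gt0).
have [j yj] := Yy (e / 3) ltac:(by rewrite divr_gt0).
have di : 0 < `|D i| + 1 by rewrite ltr_wpDl.
have [q] : exists q : rat, ratr q \in `]s, s + e / 3 / (`|D i| + 1)[.
  by apply: rat_in_itvoo; rewrite ltrDl !divr_gt0.
rewrite in_itv /= => /andP[q1 q2].
have [n nE] := Dq q i j; exists n; rewrite nE.
have -> : s *: x + y - (ratr q *: D i + D j) =
    s *: (x - D i) + (s - ratr q) *: D i + (y - D j).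
  by rewrite scalerBr scalerBl subrKA opprD addrACA.
apply: le_lt_trans (ler_normD _ _) _; apply: le_lt_trans (lerD (ler_normD _ _) (lexx _)) _.
rewrite !normrZ.
have H1 : `|s| * `|x - D i| <= e / 3.
  apply: le_trans (_ : (`|s| + 1) * `|x - D i| <= _).
    by rewrite ler_wpM2r // lerDl.
  by rewrite mulrC -ler_pdivlMr // ltW.
have H2 : `|s - ratr q| * `|D i| <= e / 3.
  apply: le_trans (_ : `|s - ratr q| * (`|D i| + 1) <= _).
    by rewrite ler_wpM2l // lerDl.
  rewrite -ler_pdivlMr // distrC gtr0_norm ?subr_gt0 //.
  by rewrite lerBlDl ltW.
lra.
Qed.

Definition frechet_along Y F y (a : X -> R) := forall e : R, 0 < e ->
  exists2 d : R, 0 < d & forall u, Y u -> `|u| <= d ->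
    (F y + (a u - e * `|u|)%:E <= F (y + u)%R)%E.

(** Tolerance [1 / n.+1] near 0, while the second term, absent for [t <= 1 / k.+1], grows fast
    enough for large [k] to make the inequality trivial at a distance. The local Fréchet condition
    thus becomes global inequalities with a Lipschitz slack. *)
Definition slack (n k : nat) (t : R) := t / n.+1%:R + Num.max 0 (k%:R * t - 1).

Lemma slack_lip n k (s t : R) : slack n k s <= slack n k t + (1 + k%:R) * `|s - t|.
Proof.
rewrite /slack mulrDl mul1r addrACA lerD //.
  rewrite -lerBlDl -mulrBl; apply: le_trans (ler_norm _) _.
  rewrite normrM ler_piMr // ger0_norm ?invr_ge0 //.
  by rewrite invf_le1 // ler1n.
rewrite ge_max; apply/andP; split.
  by rewrite addr_ge0 ?mulr_ge0 // le_max lexx.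
have H : k%:R * (s - t) <= k%:R * `|s - t| by rewrite ler_wpM2l // ler_norm.
have : k%:R * t - 1 <= Num.max 0 (k%:R * t - 1) by rewrite le_max lexx orbT.
by move: H; rewrite mulrBr; lra.
Qed.

Lemma slack_ge_div n k (t : R) : t / n.+1%:R <= slack n k t.
Proof. by rewrite /slack lerDl le_max lexx. Qed.

Lemma slack_ge_mul n k (t : R) : 0 <= t -> k%:R * t - 1 <= slack n k t.
Proof.
move=> t0; rewrite /slack; apply: le_trans (_ : Num.max 0 (k%:R * t - 1) <= _).
  by rewrite le_max lexx orbT.
by rewrite lerDr divr_ge0.
Qed.

Lemma slack_small n k (t : R) : 0 <= t <= k.+1%:R^-1 -> slack n k t = t / n.+1%:R.
Proof.
move=> /andP[t0 tk]; rewrite /slack (max_idPl _) ?addr0 // subr_le0.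
apply: le_trans (_ : k.+1%:R * t <= _); first by rewrite ler_wpM2r // ler_nat.
by rewrite mulrC -ler_pdivlMr ?mul1r.
Qed.

Lemma frechet_along_slack {Y F y c a} : dual_ball c a -> (forall z, 0 <= F z)%E ->
  F y \is a fin_num -> frechet_along Y F y a ->
  exists k : nat -> nat, forall n u, Y u ->
    (F y + (a u - slack n (k n) `|u|)%:E <= F (y + u)%R)%E.
Proof.
move=> ba F0 Fy fr.
suff /choice[k kP] n : exists k : nat, forall u, Y u ->
    (F y + (a u - slack n k `|u|)%:E <= F (y + u)%R)%E by exists k.
have [d d0 dP] := fr n.+1%:R^-1 ltac:(by rewrite invr_gt0).
(* For [|u| > d] this gives [b * |u| - 1 >= c * |u| + F y], so the left-hand side is at most
   [0 <= F (y + u)]. *)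
pose b := c + (fine (F y) + 1) / d.
have [k bk] : exists k : nat, b <= k%:R.
  by exists (Num.truncn `|b|).+1; rewrite (le_trans (ler_norm _)) // ltW // truncnS_gt.
exists k => u Yu; have [ud|du] := leP `|u| d.
  apply: le_trans (dP u Yu ud); rewrite leeD2l // lee_fin lerD2l lerN2.
  by rewrite mulrC slack_ge_div.
apply: le_trans (F0 _); rewrite -(fineK Fy) -EFinD lee_fin.
have := slack_ge_mul n k _ (normr_ge0 u).
have : b * `|u| <= k%:R * `|u| by rewrite ler_wpM2r.
have : fine (F y) + 1 <= (fine (F y) + 1) / d * `|u|.
  rewrite mulrAC ler_pdivlMr // ler_wpM2l ?(ltW du) //.
  by rewrite addr_ge0 // fine_ge0.
have -> : b * `|u| = c * `|u| + (fine (F y) + 1) / d * `|u| by rewrite -mulrDl.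
have := dual_ball_le ba (x := u); lra.
Qed.

Section Families.
Context (F : X -> \bar R) (c : R) (c0 : 0 <= c).

(* [((n, k), (weight, value above F, point))], with [(n, k)] the slack parameters. *)
Definition entry : Type := (nat * nat) * (R * R * X).
Definition weight (e : entry) : R := e.2.1.1.
Definition admissible (e : entry) : bool :=
  (0 <= weight e) && (F e.2.2 <= e.2.1.2%:E)%E.
Definition total (l : seq entry) : R := \sum_(e <- l) weight e.
Definition bary (y : X) (l : seq entry) : X :=
  \sum_(e <- l) weight e *: (e.2.2 - y).
Definition excess (y : X) (r : R) (l : seq entry) : R :=
  \sum_(e <- l) weight e * (e.2.1.2 - r + slack e.1.1 e.1.2 `|e.2.2 - y|).
(** The weighted sum of the constraints in [l] is [a (bary y l) <= excess y r l]; a negative gap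
    says that no [a] of norm at most [c] satisfies it. *)
Definition gap (y : X) (r : R) (l : seq entry) : R :=
  excess y r l + c * `|bary y l|.

Definition params_lip (p : seq (nat * nat)) : R :=
  c + \sum_(q <- p) (1 + q.2%:R).

Lemma params_lip_ge0 p : 0 <= params_lip p.
Proof. by rewrite addr_ge0 // sumr_ge0 // => i _; rewrite addr_ge0. Qed.

(** Relative to the total weight, the constant depends only on the slack parameters and not on the
    points, so it is the same for a family and for the one that replaces it. *)
Lemma gap_lip y z (r s : R) l : all admissible l ->
  gap y r l <= gap z s l +
    total l * (`|s - r| + params_lip [seq e.1 | e <- l] * `|y - z|).
Proof.
move=> adm.
have w0 e : e \in l -> 0 <= weight e by move=> /(allP adm)/andP[].
have T0 : 0 <= total l.
  by rewrite /total big_seq; apply: sumr_ge0 => e; exact: w0.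
have k_le e : e \in l -> 1 + e.1.2%:R <= \sum_(q <- [seq e.1 | e <- l]) (1 + q.2%:R) :> R.
  move=> el; rewrite big_map (big_rem e) //= lerDl.
  by apply: sumr_ge0 => i _; rewrite addr_ge0.
set S := \sum_(q <- _) _ in k_le.
have H1 : `|bary y l| <= `|bary z l| + total l * `|y - z|.
  have -> : bary y l = bary z l + total l *: (z - y).
    rewrite /bary /total scaler_suml -big_split /=; apply: eq_bigr => e _.
    by rewrite -scalerDr addrA subrK.
  by apply: le_trans (ler_normD _ _) _; rewrite normrZ ger0_norm // distrC.
have H2 : excess y r l <= excess z s l + total l * (`|s - r| + S * `|y - z|).
  rewrite /excess /total mulr_suml -big_split /= !big_seq; apply: ler_sum => e el.
  rewrite -mulrDr ler_wpM2l ?w0 //.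
  have := slack_lip e.1.1 e.1.2 `|e.2.2 - y| `|e.2.2 - z|.
  have : `| `|e.2.2 - y| - `|e.2.2 - z| | <= `|y - z|.
    apply: le_trans (ler_dist_dist _ _) _.
    by rewrite opprB addrC subrKA distrC.
  move=> /(ler_wpM2l (addr_ge0 ler01 (ler0n _ e.1.2))).
  have := ler_wpM2r (normr_ge0 (y - z)) (k_le _ el).
  have := ler_norm (s - r); lra.
have := ler_wpM2l c0 H1; rewrite /gap /params_lip -/S; move: H2; lra.
Qed.

Lemma gap_ge0 y r (a : X -> R) l : dual_ball c a -> all admissible l ->
  (forall e, e \in l -> a (e.2.2 - y) <= e.2.1.2 - r + slack e.1.1 e.1.2 `|e.2.2 - y|) ->
  0 <= gap y r l.
Proof.
move=> [la aN] adm H.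
have w0 e : e \in l -> 0 <= weight e by move=> /(allP adm)/andP[].
have : a (bary y l) <= excess y r l.
  have -> : a (bary y l) = \sum_(e <- l) weight e * a (e.2.2 - y).
    rewrite /bary; elim: l {adm H w0} => [|e l IH].
      by rewrite !big_nil (linear_fun0 la).
    by rewrite !big_cons (linear_funD la) (linear_funZ la) IH.
  rewrite /excess !big_seq; apply: ler_sum => e el.
  by rewrite ler_wpM2l ?w0 // H.
have := aN (bary y l); rewrite ler_norml => /andP[]; rewrite /gap; lra.
Qed.

(** The summed constraints form a cone, and nonnegative gaps are its compatibility with [c * |.|].
    Families of one point of weight 1 then give back the inequality at each [u]. *)
Lemma slack_subgradient y r (k : nat -> nat) : F y = r%:E ->
  (forall z, 0 <= F z)%E ->
  (forall l, all admissible l -> (forall e, e \in l -> e.1.2 = k e.1.1) ->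
    0 <= gap y r l) ->
  exists a, dual_ball c a /\ frechet_along setT F y a.
Proof.
move=> Fy F0 H.
pose K w s := exists l, [/\ all admissible l, (forall e, e \in l -> e.1.2 = k e.1.1),
  w = bary y l & s = excess y r l].
have [||a [ba aK]] := dual_ball_cone K c0.
- split=> [|v w s t [l [al kl -> ->]] [l' [al' kl' -> ->]]|t v s t0 [l [al kl -> ->]]].
  + by exists [::]; split=> //; rewrite /bary /excess big_nil.
  + exists (l ++ l'); split; rewrite ?all_cat ?al //.
    * by move=> e; rewrite mem_cat => /orP[/kl|/kl'].
    * by rewrite /bary big_cat.
    * by rewrite /excess big_cat.
  + exists [seq (e.1, (t * weight e, e.2.1.2, e.2.2)) | e <- l]; split.
    * rewrite all_map; apply/allP => e /(allP al) /andP[w0 Fe].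
      by rewrite /admissible /weight /= Fe andbT mulr_ge0 // ltW.
    * by move=> _ /mapP[e el ->] /=; exact: kl.
    * by rewrite /bary big_map scaler_sumr; apply: eq_bigr => e _; rewrite scalerA.
    * by rewrite /excess big_map mulr_sumr; apply: eq_bigr => e _; rewrite mulrA.
- by move=> w s [l [al kl -> ->]]; exact: H.
exists a; split=> // e e0.
have [n ne] : exists n : nat, n.+1%:R^-1 <= e.
  have [n _ /(_ _ (leqnn n)) /= /ltW ?] := near_infty_natSinv_lt (PosNum e0).
  by exists n.
exists (k n).+1%:R^-1 => [|u _ ud]; first by rewrite invr_gt0.
have [Ffin|Finf] := boolP (F (y + u) \is a fin_num); last first.
  by move: Finf; rewrite ge0_fin_numE // -leNgt leye_eq => /eqP ->; rewrite leey.
pose l : seq entry := [:: ((n, k n), (1, fine (F (y + u)), y + u))].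
have := aK (bary y l) (excess y r l).
rewrite /bary /excess !big_seq1 /weight /= scale1r mul1r addrAC subrr add0r.
have us : slack n (k n) `|u| = `|u| / n.+1%:R by apply: slack_small; rewrite normr_ge0.
rewrite us.
move=> aKu; rewrite Fy -(fineK Ffin) -EFinD lee_fin.
have : a u <= fine (F (y + u)) - r + `|u| / n.+1%:R.
  apply: aKu; exists l; split.
  - by rewrite /= andbT /admissible /weight /= ler01 fineK // lexx.
  - by move=> e'; rewrite inE => /eqP ->.
  - by rewrite /bary big_seq1 /weight /= scale1r addrAC subrr add0r.
  - by rewrite /excess big_seq1 /weight /= mul1r [y + u - y]addrAC subrr add0r us.
by have := ler_wpM2l (normr_ge0 u) ne; move: (`|u| / _) => q; lra.
Qed.

End Families.

(* The gaps at [(y, F y)] and at a nearby rational datum [(D i, r)] differ by a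
   small multiple of the total weight, so it is enough to close [D] under the
   choice, for every such datum, of one family whose gap is below a fixed negative
   multiple of its weight. *)
Lemma separable_reduction F (c : R) x : 0 <= c -> (forall z, 0 <= F z)%E ->
  exists D : nat -> X, [/\ is_subspace (closure (range D)), closure (range D) x &
    forall y a, closure (range D) y -> F y \is a fin_num -> dual_ball c a ->
      frechet_along (closure (range D)) F y a ->
      exists b, dual_ball c b /\ frechet_along setT F y b].
Proof.
move=> c0 F0.
pose bad (st : X * rat * rat * seq (nat * nat)) (l : seq entry) :=
  [/\ [seq e.1 | e <- l] = st.2, all (admissible F) l &
      gap c st.1.1.1 (ratr st.1.1.2) l < - (ratr st.1.2 * total l)].
(* [W] returns the points of one bad family for the datum, or an empty list. *)
have /choice[W WP] (st : X * rat * rat * seq (nat * nat)) : exists pts : seq X,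
    (exists l, bad st l) -> exists l, bad st l /\ [seq e.2.2 | e <- l] = pts.
  have [[l bl]|nbl] := pselect (exists l, bad st l).
    by exists [seq e.2.2 | e <- l] => _; exists l.
  by exists [::].
pose op i (a b : X) : X :=
  match unpickle i : option (rat + rat * rat * seq (nat * nat) * nat) with
  | Some (inl q) => ratr q *: a + b
  | Some (inr (r, s, p, j)) => nth 0 (W (a, r, s, p)) j
  | None => 0
  end.
have [D [[n0 Dx] Dop]] := countable_closure_op x op.
have Dlin (q : rat) i j : exists n, D n = ratr q *: D i + D j.
  have [n nE] := Dop (pickle (inl q : rat + rat * rat * seq (nat * nat) * nat)) i j.
  by exists n; rewrite nE /op pickleK.
have DW st i z : st.1.1.1 = D i -> z \in W st -> exists n, D n = z.
  case: st => [[[d r] s] p] /= -> zW.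
  have [n nE] := Dop (pickle (inr (r, s, p, index z (W (D i, r, s, p)))
    : rat + rat * rat * seq (nat * nat) * nat)) i i.
  by exists n; rewrite nE /op pickleK nth_index.
exists D; split; first exact: closure_range_subspace.
  by apply: subset_closure; exists n0.
move=> y a Yy Fy ba fa.
set Y := closure (range D) in Yy fa *.
have sY : is_subspace Y by exact: closure_range_subspace.
have [k kP] := frechet_along_slack ba F0 Fy fa.
have FyE : F y = (fine (F y))%:E by rewrite fineK.
apply: (slack_subgradient F c c0 y (fine (F y)) k) => // l al kl.
rewrite leNgt; apply/negP => gl.
have w0 e : e \in l -> 0 <= weight e by move=> /(allP al)/andP[].
have Tge e : e \in l -> weight e <= total l.
  move=> el; rewrite /total (big_rem e) //= lerDl big_seq.
  by apply: sumr_ge0 => e' /mem_rem; exact: w0.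
have T_ge0 : 0 <= total l by rewrite /total big_seq; apply: sumr_ge0.
have T0 : 0 < total l.
  rewrite lt_def T_ge0 andbT; apply/eqP => T0.
  have wz e : e \in l -> weight e = 0.
    by move=> el; apply/eqP; rewrite eq_le w0 // andbT -T0 Tge.
  move: gl; rewrite /gap /excess /bary !big_seq big1; last first.
    by move=> e el; rewrite wz // mul0r.
  by rewrite big1 ?normr0 ?mulr0 ?addr0 ?ltxx // => e el; rewrite wz // scale0r.
(* With [ratr s < g / 2] and a change of datum costing at most [ratr s] per unit of weight, [l] is
   bad at [(D i, r)], and any bad family there still has a negative gap at [(y, F y)]. *)
pose g := - gap c y (fine (F y)) l / total l.
have g0 : 0 < g by rewrite divr_gt0 // oppr_gt0.
have glE : gap c y (fine (F y)) l = - (g * total l).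
  by rewrite /g !mulNr opprK divfK // gt_eqF.
have [s] : exists s : rat, ratr s \in `]0, g / 2[ by apply: rat_in_itvoo; lra.
rewrite in_itv /= => /andP[s0 sg].
pose p := [seq e.1 | e <- l]; pose L := params_lip c p.
have L0 : 0 <= L := params_lip_ge0 c c0 p.
have s20 : 0 < ratr s / 2 :> R by rewrite divr_gt0.
have [i yi] := (closure_rangeP D y).1 Yy (ratr s / 2 / (L + 1))
  (divr_gt0 s20 (ltr_wpDl L0 ltr01)).
have [r] : exists r : rat, ratr r \in `]fine (F y), fine (F y) + ratr s / 2[.
  by apply: rat_in_itvoo; lra.
rewrite in_itv /= => /andP[r1 r2].
have close : `|ratr r - fine (F y)| + L * `|y - D i| <= ratr s.
  have : L * `|y - D i| <= ratr s / 2.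
    apply: le_trans (_ : (L + 1) * `|y - D i| <= _).
      by rewrite ler_wpM2r // lerDl.
    by rewrite mulrC -ler_pdivlMr ?ltr_wpDl // ltW.
  rewrite gtr0_norm ?subr_gt0 //; lra.
have [|l' [[pl' al' gl'] ptl']] := WP (D i, r, s, p).
  exists l; split=> //=.
  apply: le_lt_trans (gap_lip F c c0 (D i) y (ratr r) (fine (F y)) l al) _.
  rewrite -/p -/L distrC [`|D i - y|]distrC glE.
  have := ler_wpM2l (ltW T0) close.
  have := ltr_pM2r T0 (ratr s) (g / 2); rewrite sg.
  by lra.
rewrite /= in pl' gl'.
have T'0 : 0 <= total l'.
  by rewrite /total big_seq; apply: sumr_ge0 => e /(allP al')/andP[].
have : gap c y (fine (F y)) l' < 0.
  apply: le_lt_trans (gap_lip F c c0 y (D i) (fine (F y)) (ratr r) l' al') _.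
  rewrite pl' -/L; have := ler_wpM2l T'0 close; lra.
(* The points of [l'] lie in [Y], where [a] satisfies all the constraints, so its gap cannot be
   negative. *)
rewrite ltNge => /negP; apply; apply: (gap_ge0 F c y _ a l') => // e el.
have kE : e.1.2 = k e.1.1.
  have : e.1 \in p by rewrite -pl' map_f.
  by move=> /mapP[e' /kl kE' ->].
have Ye : Y (e.2.2 - y).
  apply: (subspaceD sY); last exact: (subspaceN sY).
  have [n <-] : exists n, D n = e.2.2.
    apply: (DW (D i, r, s, p) i) => //; rewrite -ptl'.
    exact: (map_f (fun e : entry => e.2.2) el).
  by apply: subset_closure; exists n.
have /andP[_ Fe] := allP al' _ el.
have := le_trans (kP e.1.1 _ Ye); rewrite [y + _]addrC subrK => /(_ _ Fe).
by rewrite FyE -EFinD lee_fin /= -kE; lra.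
Qed.

End SeparableReduction.

(** * Subgradients of small norm near a point, and the error bound *)

Section SubgradientNear.
Context {R : realType} {X : completeNormedModType R}.
Implicit Types (f F : X -> \bar R).

Lemma norm_approx_norm (rho : R) : 0 < rho ->
  approx_norm rho (fun z : X => `|z|).
Proof.
move=> rho0; split=> [|z|z|z w|z w t _ _ /andP[t0 t1]].
- exact: normr0.
- exact: normr_ge0.
- by rewrite gerBl ltW.
- by have := ler_normD w (z - w); rewrite subrKC mul1r.
- apply: le_trans (ler_normD _ _) _.
  by rewrite !normrZ ger0_norm // [`|1 - t|]ger0_norm // subr_ge0.
Qed.

Lemma subgradient_near_asplund F x (c mu eta : R) : asplund X ->
  lower_semicontinuous F -> (forall z, 0 <= F z)%E -> (F x < +oo)%E ->
  0 < c -> 0 < mu -> 0 < eta ->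
  exists y a, [/\ (F y + (c * `|y - x|)%:E <= F x + eta%:E)%E,
    dual_ball (c + mu) a & frechet_along setT F y a].
Proof.
move=> aX lF F0 Fx c0 mu0 eta0.
have cm0 : 0 <= c + mu by rewrite addr_ge0 // ltW.
have [D [sY Yx red]] := separable_reduction F (c + mu) x cm0 F0.
set Y := closure (range D) in sY Yx red.
have YD n : Y (D n) by apply: subset_closure; exists n.
have dD y (d : R) : Y y -> 0 < d -> exists n, `|y - D n| < d.
  by move=> /closure_rangeP; exact.
have [y [h [[Yy yx ymin] [hL hc hs]]]] := variational_principle x c mu eta
  (@closed_closure _ _) lF F0 Yx Fx c0 mu0 eta0
  (fun rho => exists_approx_norm D rho aX sY YD dD).
have Fy : F y \is a fin_num.
  rewrite ge0_fin_numE //; apply: le_lt_trans (_ : F x + eta%:E < +oo)%E.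
    by apply: le_trans yx; rewrite leeDl // lee_fin mulr_ge0 // ltW.
  by rewrite lte_add_pinfty // ltry.
have [a [aL ah]] := convex_on_subgradient y cm0 hc hL.
have bL : dual_ball (c + mu) (fun z => - a z).
  split=> [s z w|z]; last by rewrite normrN; exact: aL.2.
  by rewrite aL.1 opprD mulrN.
have [|b [bL' bF]] := red y (fun z => - a z) Yy Fy bL; last by exists y, b.
(* Smoothness and [h (y - u) >= h y - a u] give [h (y + u) <= h y + a u + e * |u|]; minimality of
   [F + h] at [y] does the rest. *)
move=> e e0; have [d d0 dP] := hs y e e0.
exists d => // u Yu ud.
have := ymin _ (subspaceD sY _ _ Yy Yu).
have [Fu|] := boolP (F (y + u) \is a fin_num); last first.
  by rewrite ge0_fin_numE // -leNgt leye_eq => /eqP -> _; rewrite leey.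
rewrite -(fineK Fy) -(fineK Fu) -!EFinD !lee_fin.
have := dP _ Yu ud; have := ah (- u); rewrite (linear_funN aL.1); lra.
Qed.

Lemma subgradient_near_convex F x (c mu eta : R) : convex_efun F ->
  lower_semicontinuous F -> (forall z, 0 <= F z)%E -> (F x < +oo)%E ->
  0 < c -> 0 < mu -> 0 < eta ->
  exists y a, [/\ (F y + (c * `|y - x|)%:E <= F x + eta%:E)%E,
    dual_ball (c + mu) a & frechet_along setT F y a].
Proof.
move=> cF lF F0 Fx c0 mu0 eta0.
have cm0 : 0 <= c + mu by rewrite addr_ge0 // ltW.
(* Smoothness along the zero subspace is trivial, so the norm itself is a gauge. *)
have gauges (rho : R) : 0 < rho ->
    exists2 g : X -> R, approx_norm rho g & smooth_along [set 0] g.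
  move=> rho0; exists (fun z => `|z|); first exact: norm_approx_norm.
  move=> z e e0; exists 1 => // _ -> _.
  by rewrite addr0 subr0 normr0 mulr0; lra.
have [y [h [[_ yx ymin] [hL hc _]]]] := variational_principle x c mu eta
  closedT lF F0 (I : setT x) Fx c0 mu0 eta0 gauges.
have Fy : F y \is a fin_num.
  rewrite ge0_fin_numE //; apply: le_lt_trans (_ : F x + eta%:E < +oo)%E.
    by apply: le_trans yx; rewrite leeDl // lee_fin mulr_ge0 // ltW.
  by rewrite lte_add_pinfty // ltry.
have [|v w r s t t01 Cv Cw|v r Cv|a [aL aF]] :=
  @dual_ball_convex R X (c + mu) (fun v r => (F (y + v)%R <= (fine (F y) + r)%:E)%E) cm0.
- by rewrite !addr0 fineK.
- have /andP[t0 t1] := t01.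
  have := cF (y + v) (y + w) t t01.
  rewrite !scalerDr addrACA -scalerDl subrKC scale1r => /le_trans; apply.
  apply: le_trans (_ : t%:E * (fine (F y) + r)%:E +
      (1 - t)%:E * (fine (F y) + s)%:E <= _)%E.
    by rewrite leeD // lee_wpmul2l // lee_fin ltW // subr_gt0.
  by rewrite -!EFinM -EFinD lee_fin; lra.
- have := ymin (y + v) I; rewrite -(fineK Fy) => /le_trans.
  move=> /(_ ((fine (F y) + r)%:E + (h (y + v))%:E)%E).
  rewrite leeD2r // => /(_ isT); rewrite -!EFinD lee_fin.
  by have := hL (y + v) y; rewrite addrAC subrr add0r; lra.
exists y, a; split=> // e e0; exists 1 => // u _ _.
have [Fu|] := boolP (F (y + u) \is a fin_num); last first.
  by rewrite ge0_fin_numE // -leNgt leye_eq => /eqP ->; rewrite leey.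
have := aF u (fine (F (y + u)) - fine (F y)); rewrite subrKC fineK // => /(_ (lexx _)).
rewrite -(fineK Fy) -(fineK Fu) -!EFinD !lee_fin /=.
have : 0 <= e * `|u| by rewrite mulr_ge0 // ltW.
lra.
Qed.

Lemma lower_semicontinuous_pos_part f :
  lower_semicontinuous f -> lower_semicontinuous (pos_part f).
Proof.
move=> lf x a; rewrite /pos_part lt_max => /orP[/lf[V Vx VP]|a0].
  by exists V => // y /VP ay; rewrite lt_max ay.
by exists setT => [|y _]; [exact: filterT|rewrite lt_max a0 orbT].
Qed.

Lemma convex_efun_pos_part f : convex_efun f -> convex_efun (pos_part f).
Proof.
move=> cf x y t t01; have /andP[t0 t1] := t01.
have P0 z : (0 <= pos_part f z)%E by rewrite /pos_part le_max lexx orbT.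
have Pf z : (f z <= pos_part f z)%E by rewrite /pos_part le_max lexx.
have t1' : (0 <= (1 - t)%:E)%E by rewrite lee_fin subr_ge0 ltW.
rewrite {1}/pos_part ge_max; apply/andP; split; last first.
  by rewrite adde_ge0 // mule_ge0 // lee_fin ltW.
by apply: le_trans (cf x y t t01) _; rewrite leeD // lee_wpmul2l // lee_fin ltW.
Qed.

(** Lower semicontinuity keeps [f] positive near [y], so there [f] and its positive part
    coincide. *)
Lemma frechet_subdiff_pos_part f y (c : R) a : lower_semicontinuous f ->
  (0 < f y)%E -> (f y < +oo)%E -> dual_ball c a ->
  frechet_along setT (pos_part f) y a -> frechet_subdiff f y a.
Proof.
move=> lf fy0 fyoo ba fa; split; [split|split=> //].
- exact: ba.1.
- apply: (@lipschitz_const_continuous _ _ c) => z w.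
  rewrite -lerBlDl -(linear_funB ba.1); exact: dual_ball_le ba.
have fy : f y \is a fin_num by rewrite ge0_fin_numE // ltW.
have posE z : (0 < f z)%E -> pos_part f z = f z.
  by move=> fz; rewrite /pos_part; apply/max_idPl; exact: ltW.
have [V /nbhs_ballP[r /= r0 rV] VP] := lf y 0 fy0.
rewrite limf_einfE; apply/lee_subgt0Pr => e e0; rewrite sub0e.
have [d d0 dP] := fa e e0.
apply: le_trans (ereal_sup_ubound _); last first.
  exists [set z | z != y /\ `|z - y| < Num.min d r] => //=.
  rewrite /dnbhs /within /=; apply/nbhs_ballP.
  exists (Num.min d r) => /=; first by rewrite lt_min d0.
  by move=> z; rewrite -ball_normE /= distrC => ? ?; split.
apply: le_ereal_inf_tmp => _ [z [zy zmin] <-].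
move: zmin; rewrite lt_min => /andP[zd zr].
have fz : (0 < f z)%E by apply: VP; apply: rV; rewrite -ball_normE /= distrC.
have zy0 : 0 < `|z - y| by rewrite normr_gt0 subr_eq0.
have := dP (z - y) I (ltW zd).
rewrite subrKC !posE //.
have [fzfin|] := boolP (f z \is a fin_num); last first.
  rewrite ge0_fin_numE ?(ltW fz) // -leNgt leye_eq => /eqP -> _.
  by rewrite -(fineK fy) /= gt0_mulye ?leey // lte_fin invr_gt0.
rewrite -(fineK fy) -(fineK fzfin) -EFinD -!EFinB -EFinM lee_fin => H.
rewrite -EFinN lee_fin ler_pdivlMr //; lra.
Qed.

Lemma dual_norm_le {c : R} {a : X -> R} : 0 <= c -> dual_ball c a ->
  (dual_norm a <= c%:E)%E.
Proof.
move=> c0 ba; apply: ge_ereal_sup => _ [x /= x1 <-].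
rewrite lee_fin; apply: le_trans (ba.2 x) _.
by rewrite ler_piMr.
Qed.

End SubgradientNear.

Theorem theorem3p4 (R : realType) (X : completeNormedModType R)
  (f : X -> \bar R) (xbar : X) (tau : R) (delta : \bar R) :
  (forall x, f x != -oo%E) ->
  lower_semicontinuous f ->
  sublevel0 f xbar ->
  0 < tau ->
  (0 < delta)%E ->
  (asplund X \/ convex_efun f) ->
  (forall x, eball xbar delta x -> (0 < f x)%E ->
     (f x < tau%:E * dist x (sublevel0 f))%E ->
     (tau%:E <= dist0_subdiff f x)%E) ->
  forall (alpha : R), 0 < alpha <= 1 ->
  forall x, eball xbar (delta * ((1 + alpha)^-1)%:E)%E x ->
    ((alpha * tau)%:E * dist x (sublevel0 f) <= pos_part f x)%E.
Proof.
move=> _ lf Sxbar tau0 delta0 AC H alpha /andP[al0 al1] x xball.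
set S := sublevel0 f in Sxbar H *; set F := pos_part f.
have F0 z : (0 <= F z)%E by rewrite /F /pos_part le_max lexx orbT.
have lF : lower_semicontinuous F := lower_semicontinuous_pos_part f lf.
have dist_le z s : S s -> (dist z S <= (`|z - s|)%:E)%E.
  by move=> Ss; apply: ereal_inf_lbound; exists s.
have dist_fin z : dist z S \is a fin_num.
  rewrite ge0_fin_numE; first exact: le_lt_trans (dist_le _ _ Sxbar) (ltry _).
  by apply: le_ereal_inf_tmp => _ [s _ <-]; rewrite lee_fin.
rewrite leNgt; apply/negP => Fx.
have Fxoo : (F x < +oo)%E by exact: lt_le_trans Fx (leey _).
have Fxfin : F x \is a fin_num by rewrite ge0_fin_numE.
pose d := fine (dist x S); pose r := fine (F x).
have dE : dist x S = d%:E by rewrite fineK.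
have rd : r < alpha * tau * d by move: Fx; rewrite dE -(fineK Fxfin) -EFinM lte_fin.
have r0 : 0 <= r by exact: fine_ge0.
have d0 : 0 < d by rewrite -(pmulr_rgt0 d (mulr_gt0 al0 tau0)) (le_lt_trans r0).
have ad0 : 0 < alpha * d by exact: mulr_gt0.
(* The failure means [q < tau]. Then [q < c], [c + mu = (3 * tau + q) / 4 < tau], and [eta] is half
   of the margin between [F x = q * (alpha * d)] and [c * (alpha * d)]. *)
pose q := r / (alpha * d).
have qr : q * (alpha * d) = r by rewrite divfK // gt_eqF.
have q0 : 0 <= q by rewrite divr_ge0 // ltW.
have qt : q < tau by rewrite ltr_pdivrMr // mulrC mulrAC.
pose c := (tau + q) / 2; pose mu := (tau - q) / 4.
have c0 : 0 < c by rewrite /c; lra.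
have mu0 : 0 < mu by rewrite /mu; lra.
pose eta := (c - q) * (alpha * d) / 2.
have cq0 : 0 < (c - q) * (alpha * d) by rewrite mulr_gt0 // /c; lra.
have eta0 : 0 < eta by rewrite divr_gt0.
have [y [a [yx aL aF]]] : exists y a, [/\ (F y + (c * `|y - x|)%:E <= F x + eta%:E)%E,
    dual_ball (c + mu) a & frechet_along setT F y a].
  case: AC => [aX|cf]; first exact: subgradient_near_asplund.
  by apply: subgradient_near_convex => //; exact: convex_efun_pos_part.
have Fyfin : F y \is a fin_num.
  rewrite ge0_fin_numE //; apply: le_lt_trans (_ : F x + eta%:E < +oo)%E.
    by apply: le_trans yx; rewrite leeDl // lee_fin mulr_ge0 // ltW.
  by rewrite lte_add_pinfty // ltry.
have Fy0 : 0 <= fine (F y) by exact: fine_ge0.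
have {}yx : fine (F y) + c * `|y - x| < c * (alpha * d).
  move: yx; rewrite -(fineK Fyfin) -(fineK Fxfin) -!EFinD lee_fin -/r -qr.
  by move: cq0; rewrite /eta; lra.
have yxd : `|y - x| < alpha * d by rewrite -(ltr_pM2l c0); lra.
have add : alpha * d <= d by rewrite ler_piMl // ltW.
have yS : ~ S y.
  by move=> /(dist_le x); rewrite dE lee_fin distrC => ?; lra.
have fy0 : (0 < f y)%E by rewrite ltNge; apply/negP => ?; exact: yS.
have FyE : F y = f y by rewrite /F /pos_part; apply/max_idPl; exact: ltW.
have dy : ((d - `|y - x|)%:E <= dist y S)%E.
  apply: le_ereal_inf_tmp => _ [s Ss <-]; have := dist_le x s Ss.
  rewrite dE !lee_fin => ds.
  by have := ler_normD (x - y) (y - s); rewrite subrKA [`|x - y|]distrC; lra.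
(* As [xbar] lies in [S], [d <= |x - xbar|], so [|y - xbar| < alpha * d + |x - xbar| <= (1 + alpha)
   * |x - xbar|]: the origin of the radius [delta / (1 + alpha)]. *)
have ybal : eball xbar delta y.
  have xd : d <= `|x - xbar| by have := dist_le x _ Sxbar; rewrite dE lee_fin.
  have yb : `|y - xbar| < (1 + alpha) * `|x - xbar|.
    have := ler_normD (y - x) (x - xbar); rewrite subrKA.
    by have := ler_wpM2l (ltW al0) xd; lra.
  move: xball; rewrite /eball /=; case: delta delta0 {H} => [e| |] //=; last first.
    by move=> _ _; rewrite ltry.
  move=> _; rewrite -EFinM !lte_fin ltr_pdivlMr ?addr_gt0 // => xe.
  by apply: lt_trans yb _; rewrite mulrC.
(* [F y < c * (alpha * d - |y - x|) <= tau * (d - |y - x|)], and the distance to [S] drops by at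
   most [|y - x|] from [x] to [y]. *)
have ft : (f y < tau%:E * dist y S)%E.
  apply: lt_le_trans (_ : (tau * (d - `|y - x|))%:E <= _)%E; last first.
    by rewrite EFinM lee_wpmul2l // lee_fin ltW.
  rewrite -FyE -(fineK Fyfin) lte_fin.
  have : c * (alpha * d) <= c * d by rewrite ler_pM2l.
  have : c * (d - `|y - x|) <= tau * (d - `|y - x|).
    by rewrite ler_wpM2r // /c; lra.
  lra.
have sub : frechet_subdiff f y a.
  apply: (frechet_subdiff_pos_part f y (c + mu) a) => //.
  by rewrite -FyE -ge0_fin_numE.
have := H y ybal fy0 ft; apply/negP; rewrite -ltNge.
apply: le_lt_trans (_ : (c + mu)%:E < _)%E; last first.
  by rewrite lte_fin /c /mu; lra.
apply: le_trans (dual_norm_le _ aL); last by rewrite addr_ge0 // ltW.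
by apply: ereal_inf_lbound; exists a.
Qed.
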